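(* Let $G$ be a unipotent algebraic $\mathbb{Z}$-group and $p$ a prime. For each $k$, the map $\Delta\mapsto\overline{\Delta}$ sending a subgroup to its closure in $G(\mathbb{Q}_p)$ is a one-to-one correspondence between $\mathcal{L}_{p^k}(G)$ and the set of closed subgroups $H$ of $G(\mathbb{Q}_p)$ with $\mathrm{c}(H,G(\mathbb{Z}_p)) = p^k$.
   Context: A unipotent algebraic $\mathbb{Z}$-group is a unipotent algebraic group $G$ defined over $\mathbb{Z}$. It is regarded as embedded as a closed subgroup of a group of lower-triangular unipotent matrices (Kolchin's theorem), and $G(R)$ denotes its group of $R$-points. For subgroups $A,B$ of a common group, the commensurability index is $\mathrm{c}(A,B) := [A:A\cap B]\,[B:A\cap B]$; the two subgroups are commensurable if this is finite. An arithmetic lattice in $G$ is a subgroup of $G(\mathbb{R})$ commensurable with $G(\mathbb{Z})$; every arithmetic lattice is contained in $G(\mathbb{Q})\subseteq G(\mathbb{Q}_p)$, so its closure in $G(\mathbb{Q}_p)$ (with the $p$-adic topology) makes sense. $\mathcal{L}_n(G)$ is the set of arithmetic lattices $\Delta$ in $G$ with $\mathrm{c}(\Delta,G(\mathbb{Z}))=n$. *)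

(* Defs.v *)
From HB Require Import structures.
From mathcomp Require Import all_boot all_order all_algebra.
From mathcomp Require Import boolp classical_sets functions cardinality.
From mathcomp Require Import reals topology mpoly.

Set Implicit Arguments.
Unset Strict Implicit.
Unset Printing Implicit Defensive.

Import GRing.Theory.

Local Open Scope classical_set_scope.
Local Open Scope ring_scope.

(* Z_p is the inverse limit of the rings Z/p^n: an element is given by its
   residues modulo all p^n.  The coherence condition also forces
   residue n < p ^ n, so that equality of p-adic integers is equality of the
   residue sequences. *)
Record padic_int (p : nat) (p_pr : prime p) := PadicInt {
  residue : nat -> nat;
  residue_coherent : `[< forall n, residue n = (residue n.+1 %% p ^ n)%N >]
}.

Section PadicInt.
Variables (p : nat) (p_pr : prime p).
Local Notation Zp := (padic_int p_pr).
Implicit Types x y z : Zp.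

HB.instance Definition _ := [isSub for @residue p p_pr].
HB.instance Definition _ := [Choice of Zp by <:].

Local Open Scope nat_scope.

Let p_gt0 : 0 < p := prime_gt0 p_pr.

Lemma residueE x n : residue x n = residue x n.+1 %% p ^ n.
Proof. by have /asboolP := residue_coherent x; apply. Qed.

Lemma residue_mod x n : residue x n %% p ^ n = residue x n.
Proof. by rewrite residueE modn_mod. Qed.

Lemma residue_modD x m n : residue x (n + m) %% p ^ n = residue x n.
Proof.
elim: m => [|m IHm]; first by rewrite addn0 residue_mod.
rewrite -IHm addnS [residue x (n + m)]residueE modn_dvdm //.
by rewrite dvdn_exp2l ?leq_addr.
Qed.

Lemma padic_intP x y : (forall n, residue x n = residue y n) -> x = y.
Proof. by move=> xy; apply/val_inj/funext. Qed.

Lemma modn_expS a n : (a %% p ^ n.+1) %% p ^ n = a %% p ^ n.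
Proof. by rewrite modn_dvdm // dvdn_exp2l. Qed.

Lemma zero_coherent : `[< forall n, 0 = 0 %% p ^ n >].
Proof. by apply/asboolP => n; rewrite mod0n. Qed.
Definition zero_padic_int : Zp := PadicInt p_pr zero_coherent.

Lemma one_coherent : `[< forall n, 1 %% p ^ n = (1 %% p ^ n.+1) %% p ^ n >].
Proof. by apply/asboolP => n; rewrite modn_expS. Qed.
Definition one_padic_int : Zp := PadicInt p_pr one_coherent.

Lemma add_coherent x y : `[< forall n, (residue x n + residue y n) %% p ^ n =
  ((residue x n.+1 + residue y n.+1) %% p ^ n.+1) %% p ^ n >].
Proof. by apply/asboolP => n; rewrite modn_expS -[RHS]modnDm -!residueE. Qed.
Definition add_padic_int x y : Zp := PadicInt p_pr (add_coherent x y).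

Lemma mul_coherent x y : `[< forall n, (residue x n * residue y n) %% p ^ n =
  ((residue x n.+1 * residue y n.+1) %% p ^ n.+1) %% p ^ n >].
Proof. by apply/asboolP => n; rewrite modn_expS -[RHS]modnMm -!residueE. Qed.
Definition mul_padic_int x y : Zp := PadicInt p_pr (mul_coherent x y).

Lemma residue_le x n : residue x n <= p ^ n.
Proof. by rewrite -residue_mod ltnW // ltn_mod expn_gt0 p_gt0. Qed.

Lemma opp_coherent x : `[< forall n, (p ^ n - residue x n) %% p ^ n =
  ((p ^ n.+1 - residue x n.+1) %% p ^ n.+1) %% p ^ n >].
Proof.
apply/asboolP => n; rewrite modn_expS; apply/eqP.
rewrite -(eqn_modDr (residue x n.+1)) subnK ?residue_le //.
rewrite -modnDmr -residueE subnK ?residue_le //.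
by rewrite modnn expnS modnMl.
Qed.
Definition opp_padic_int x : Zp := PadicInt p_pr (opp_coherent x).

Lemma add_padic_intA : associative add_padic_int.
Proof. by move=> x y z; apply: padic_intP => n /=; rewrite modnDml modnDmr addnA. Qed.

Lemma add_padic_intC : commutative add_padic_int.
Proof. by move=> x y; apply: padic_intP => n /=; rewrite addnC. Qed.

Lemma add0_padic_int : left_id zero_padic_int add_padic_int.
Proof. by move=> x; apply: padic_intP => n /=; rewrite add0n residue_mod. Qed.

Lemma addN_padic_int : left_inverse zero_padic_int opp_padic_int add_padic_int.
Proof.
by move=> x; apply: padic_intP => n /=; rewrite modnDml subnK ?modnn ?residue_le.
Qed.

HB.instance Definition _ := GRing.isZmodule.Build Zp
  add_padic_intA add_padic_intC add0_padic_int addN_padic_int.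

Lemma mul_padic_intA : associative mul_padic_int.
Proof. by move=> x y z; apply: padic_intP => n /=; rewrite modnMml modnMmr mulnA. Qed.

Lemma mul_padic_intC : commutative mul_padic_int.
Proof. by move=> x y; apply: padic_intP => n /=; rewrite mulnC. Qed.

Lemma mul1_padic_int : left_id one_padic_int mul_padic_int.
Proof. by move=> x; apply: padic_intP => n /=; rewrite modnMml mul1n residue_mod. Qed.

Lemma mul_padic_intDl : left_distributive mul_padic_int add_padic_int.
Proof. by move=> x y z; apply: padic_intP => n /=; rewrite modnMml modnDm mulnDl. Qed.

Lemma one_padic_int_neq0 : one_padic_int != zero_padic_int.
Proof.
apply/eqP => /(congr1 (fun x : Zp => residue x 1)) /=.
by rewrite expn1 modn_small ?prime_gt1.
Qed.

HB.instance Definition _ := GRing.Zmodule_isComNzRing.Build Zp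
  mul_padic_intA mul_padic_intC mul1_padic_int mul_padic_intDl
  one_padic_int_neq0.

Definition unit_padic_int : pred Zp := fun x => `[< exists y : Zp, (y * x = 1)%R >].

Definition inv_padic_int x : Zp :=
  if pselect (exists y : Zp, (y * x = 1)%R) is left ex
  then sval (cid ex) else x.

Lemma mulV_padic_int : {in unit_padic_int, left_inverse 1%R inv_padic_int *%R}.
Proof.
move=> x /asboolP ux; rewrite /inv_padic_int.
by case: pselect => // ex; case: cid.
Qed.

Lemma unit_padic_intP x y : (y * x)%R = 1%R -> unit_padic_int x.
Proof. by move=> yx; apply/asboolP; exists y. Qed.

Lemma inv_padic_int_out : {in [predC unit_padic_int], inv_padic_int =1 id}.
Proof.
move=> x /negP ux; rewrite /inv_padic_int; case: pselect => // ex.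
by case: ux; apply/asboolP.
Qed.

HB.instance Definition _ := GRing.ComNzRing_hasMulInverse.Build Zp
  mulV_padic_int unit_padic_intP inv_padic_int_out.

Lemma padic_int_integral : GRing.integral_domain_axiom Zp.
Proof.
move=> x y xy0; apply/norP => -[x0 y0].
have nz (z : Zp) : (z != 0)%R -> exists n, residue z n != 0.
  move=> z0; apply: contrapT => h; move/negP: z0; apply; apply/eqP.
  apply: padic_intP => n /=; apply/eqP/negP => /negP zn; by apply: h; exists n.
have [m xm] := nz _ x0; have [n yn] := nz _ y0.
have aux (z : Zp) i j : residue z i != 0 ->
    residue z (i + j) != 0 /\ logn p (residue z (i + j)) < i.
  move=> zi; have zij : residue z (i + j) != 0.
    by apply: contraNneq zi => zij; rewrite -(residue_modD z j i) zij mod0n.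
  split=> //; rewrite ltnNge -pfactor_dvdn ?lt0n //.
  by rewrite /dvdn residue_modD.
have [xmn0 lx] := aux _ _ n xm; have [ynm0 ly] := aux _ _ m yn.
rewrite addnC in ynm0 ly.
have /eqP := congr1 (fun z : Zp => residue z (m + n)) xy0.
rewrite /= -/(dvdn _ _) pfactor_dvdn ?muln_gt0 ?lt0n ?xmn0 //.
rewrite lognM ?lt0n // leqNgt (leq_trans _ (leq_add lx ly)) //.
by rewrite addSn addnS leqW.
Qed.

HB.instance Definition _ :=
  GRing.ComUnitRing_isIntegral.Build Zp padic_int_integral.

End PadicInt.

Definition padic (p : nat) (p_pr : prime p) : Type := {fraction padic_int p_pr}.

Section PadicTopology.
Variables (p : nat) (p_pr : prime p).
Local Notation Zp := (padic_int p_pr).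
Local Notation Qp := (padic p_pr).
Local Open Scope relation_scope.

HB.instance Definition _ := GRing.Field.on Qp.

Definition padic_of_int : Zp -> Qp := @FracField.tofrac Zp.

HB.instance Definition _ := GRing.RMorphism.on padic_of_int.

(* The p-adic topology: the cosets x + p^n Z_p form a basis of neighbourhoods
   of x. *)
Definition padic_close (n : nat) : set (Qp * Qp) :=
  [set xy | exists z : Zp, xy.2 - xy.1 = p%:R ^+ n * padic_of_int z].

Definition padic_entourage : set_system (Qp * Qp) :=
  filter_from [set: nat] padic_close.

Lemma padic_close_le m n : (m <= n)%N -> padic_close n `<=` padic_close m.
Proof.
move=> mn [x y] [z /= e]; exists (p%:R ^+ (n - m) * z) => /=.
by rewrite e rmorphM rmorphXn rmorph_nat mulrA -exprD subnKC.
Qed.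

Lemma padic_entourage_filter : Filter padic_entourage.
Proof.
apply: filter_from_filter => [|m n _ _]; first by exists 0%N.
by exists (maxn m n) => // xy h; split; apply: padic_close_le h;
  rewrite ?leq_maxl ?leq_maxr.
Qed.

Lemma padic_entourage_diagonal A : padic_entourage A -> diagonal `<=` A.
Proof.
move=> [n _ sA] [x y] /diagonalP xy; apply: sA; exists 0 => /=.
by rewrite xy subrr rmorph0 mulr0.
Qed.

Lemma padic_entourage_inv A : padic_entourage A -> padic_entourage A^-1.
Proof.
move=> [n _ sA]; exists n => // -[x y] [z /= e]; apply: sA; exists (- z) => /=.
by rewrite rmorphN mulrN -e opprB.
Qed.

Lemma padic_entourage_split A : padic_entourage A ->
  exists2 B, padic_entourage B & B \; B `<=` A.
Proof.
move=> [n _ sA]; exists (padic_close n); first by exists n.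
move=> [x y] [t /= [u /= eu] [v /= ev]]; apply: sA; exists (u + v) => /=.
by rewrite rmorphD mulrDr -eu -ev [RHS]addrC subrKA.
Qed.

HB.instance Definition _ := isUniform.Build Qp padic_entourage_filter
  padic_entourage_diagonal padic_entourage_inv padic_entourage_split.

End PadicTopology.

Section ZGroup.
Variable d : nat.

Definition unitriangular (A : comNzRingType) (M : 'M[A]_d) : Prop :=
  is_trig_mx M /\ forall i, M i i = 1.

(* The variables of the polynomials are the d * d matrix entries, in the order
   of mxvec. *)
Definition eval_entries (A : comNzRingType) (M : 'M[A]_d)
  (f : {mpoly int[d * d]}) : A := mmap intr (mxvec M 0) f.

Definition zero_locus (I : set {mpoly int[d * d]}) (A : comNzRingType) :
    set 'M[A]_d :=
  [set M | unitriangular M /\ forall f, I f -> eval_entries M f = 0].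
Arguments zero_locus I A : clear implicits.

(* A closed subgroup scheme over Z of the group scheme of lower-triangular
   unipotent d x d matrices: its A-points form a subgroup for every commutative
   ring A.  The inverse is spelled out because A need not be a unitRingType. *)
Record unipotent_Zgroup := UnipotentZGroup {
  equations : set {mpoly int[d * d]};
  points_one : forall A : comNzRingType, zero_locus equations A 1%:M;
  points_mul : forall (A : comNzRingType) (M N : 'M[A]_d),
    zero_locus equations A M -> zero_locus equations A N ->
    zero_locus equations A (M *m N);
  points_inv : forall (A : comNzRingType) (M N : 'M[A]_d),
    zero_locus equations A M -> M *m N = 1%:M -> zero_locus equations A N
}.

Definition points (G : unipotent_Zgroup) (A : comNzRingType) : set 'M[A]_d :=
  zero_locus (equations G) A.
Arguments points G A : clear implicits.

Definition subgroup (A : comUnitRingType) (K H : set 'M[A]_d) : Prop :=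
  [/\ H `<=` K, H 1%:M, (forall M N, H M -> H N -> H (M *m N)) &
      forall M, H M -> H (invmx M)].

Definition index_eq (A : comUnitRingType) (K H : set 'M[A]_d) (m : nat) : Prop :=
  ([set [set M *m N | N in H] | M in K] #= `I_m)%card.

(* The relation c(K, H) = n; the index c(K, H) may be infinite. *)
Definition comm_index_eq (A : comUnitRingType) (K H : set 'M[A]_d) (n : nat) :
    Prop :=
  exists i j, [/\ index_eq K (K `&` H) i, index_eq H (K `&` H) j & n = (i * j)%N].

Definition commensurable (A : comUnitRingType) (K H : set 'M[A]_d) : Prop :=
  exists n, comm_index_eq K H n.

Section Lattices.
Variables (G : unipotent_Zgroup) (R : realType).

Definition int_points : set 'M[R]_d := map_mx intr @` points G int.

Definition arithmetic_lattice (Delta : set 'M[R]_d) : Prop :=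
  subgroup (points G R) Delta /\ commensurable Delta int_points.

Definition lattices (n : nat) : set (set 'M[R]_d) :=
  [set Delta | arithmetic_lattice Delta /\ comm_index_eq Delta int_points n].

End Lattices.

Section Closure.
Variables (G : unipotent_Zgroup) (p : nat) (p_pr : prime p).
Local Notation Qp := (padic p_pr).

Definition padic_int_points : set 'M[Qp]_d :=
  map_mx (@padic_of_int p p_pr) @` points G (padic_int p_pr).

(* Closure for the subspace topology of G(Q_p). *)
Definition closure_in_points (H : set 'M[Qp]_d) : set 'M[Qp]_d :=
  points G Qp `&` closure H.

Definition closed_subgroups (n : nat) : set (set 'M[Qp]_d) :=
  [set H | [/\ subgroup (points G Qp) H, closure_in_points H = H &
               comm_index_eq H padic_int_points n]].

(* An arithmetic lattice consists of rational matrices; those are what is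
   transported from G(R) to G(Q_p). *)
Definition lattice_closure (R : realType) (Delta : set 'M[R]_d) :
    set 'M[Qp]_d :=
  closure_in_points [set map_mx ratr M | M in
                       [set M : 'M[rat]_d | Delta (map_mx ratr M)]].

End Closure.
End ZGroup.

Arguments points {d} G A.
Arguments int_points {d} G R.
Arguments lattices {d} G R n.
Arguments padic_int_points {d} G {p} p_pr.
Arguments closed_subgroups {d} G {p} p_pr n.
Arguments lattice_closure {d} G {p} p_pr R Delta.

(* Main.v *)
(* Both sides are matched with the subgroups E of G(Z[1/p]) such that
   c(E, G(Z)) = p^k: to a lattice corresponds its set of rational matrices, to a
   closed subgroup of G(Q_p) its intersection with G(Z[1/p]).

   A group of unipotent matrices permutes the cosets of a subgroup of p-power index
   through a finite nilpotent group with a transitive action on p^a points, hence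
   through a p-group, so the subgroup contains all p^m-th powers for some m. On the
   real side, every element of the lattice is thus a p^m-th root of an integral
   matrix, and such a root has entries in Z[1/p]. Over Z or Z_p, every point of G
   close to 1 has an integral p^m-th root in G, namely C(1/p^m) for the polynomial
   curve C with C(n) = g^n, so a subgroup of p-power index in G(Z) or G(Z_p) contains
   a congruence subgroup. Hence the closures which occur are open.

   What remains is that G(Z[1/p]) is dense in G(Q_p). Every g in G(Q_p) is exp L with
   L in the Lie algebra, which is defined by linear equations over Z; so L is a limit
   of rational L' in the Lie algebra for which exp L' has entries in Z[1/p]. That
   exp L' is in G is seen on points over iterated dual numbers. *)

Require Import Defs.
From HB Require Import structures.
From mathcomp Require Import all_boot all_order all_algebra all_fingroup all_solvable.
From mathcomp Require Import zify ring.
From mathcomp Require Import boolp classical_sets functions cardinality.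
From mathcomp Require Import reals topology mpoly.

Set Implicit Arguments.
Unset Strict Implicit.
Unset Printing Implicit Defensive.

Import Num.Theory GRing.Theory.

Local Open Scope classical_set_scope.
Local Open Scope ring_scope.

(** * One-parameter subgroups *)

Section NilpotentMatrices.
Variables (A : comNzRingType) (d : nat).
Implicit Types N M : 'M[A]_d.

Definition strictly_lower N := forall i j : 'I_d, (i <= j)%N -> N i j = 0.

(** Each factor [N] moves at least one step below the diagonal. *)
Lemma exp_strictly_lower N k (i j : 'I_d) :
  strictly_lower N -> (i < j + k)%N -> (N ^+ k) i j = 0.
Proof.
move=> hN; elim: k i => [|k IHk] i; first by rewrite addn0 => ij; rewrite mxE -val_eqE ltn_eqF.
move=> ij; rewrite exprS mxE big1 // => l _.
have [il|li] := leqP i l; first by rewrite hN ?mul0r.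
by rewrite IHk ?mulr0 //; apply: leq_trans li _; rewrite -ltnS -addnS.
Qed.

Lemma strictly_lower_nilpotent N k : strictly_lower N -> (d <= k)%N -> N ^+ k = 0.
Proof.
move=> hN dk; apply/matrixP => i j; rewrite exp_strictly_lower ?mxE //.
by apply: leq_trans (ltn_ord i) (leq_trans dk (leq_addl _ _)).
Qed.

End NilpotentMatrices.

Lemma natr_ffact (R : comNzRingType) n k :
  (n ^_ k)%:R = \prod_(j < k) (n%:R - j%:R) :> R.
Proof.
elim: k => [|k IHk]; first by rewrite big_ord0.
rewrite big_ord_recr /= -IHk ffactnSr natrM.
have [kn|nk] := leqP k n; first by rewrite natrB.
by rewrite ffact_small // !mul0r.
Qed.

(** * Polynomial curves interpolating the powers of a unipotent matrix *)

Section PolynomialCurves.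
Variables (K : fieldType).
Hypothesis K0 : [pchar K] =i pred0.

Let natrK n : (n%:R == 0 :> K) = (n == 0)%N.
Proof. by move/pcharf0P: K0; apply. Qed.

Lemma poly_nat_inj (P Q : {poly K}) :
  (forall n : nat, P.[n%:R] = Q.[n%:R]) -> P = Q.
Proof.
move=> PQ; apply/eqP; rewrite -subr_eq0; apply/eqP.
pose s := [seq n%:R : K | n <- iota 0 (size (P - Q))].
apply: (@roots_geq_poly_eq0 _ _ s).
- by apply/allP => x /mapP[n _ ->]; rewrite rootE !hornerE PQ subrr.
- rewrite map_inj_uniq ?iota_uniq // => m n /eqP.
  wlog mn : m n / (m <= n)%N => [h|].
    by case: (leqP m n) => [/h//|/ltnW/h{}h]; rewrite eq_sym => /h.
  rewrite eq_sym -subr_eq0 -natrB // natrK subn_eq0 => nm.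
  by apply/eqP; rewrite eqn_leq mn.
- by rewrite size_map size_iota.
Qed.

Lemma mx_nat_inj m n (P Q : 'M[{poly K}]_(m, n)) :
  (forall k : nat, map_mx (horner_eval k%:R) P = map_mx (horner_eval k%:R) Q) ->
  P = Q.
Proof.
move=> PQ; apply/matrixP => i j; apply: poly_nat_inj => k.
by have /matrixP/(_ i j) := PQ k; rewrite !mxE /horner_eval.
Qed.

(** Binomial theorem: [(1 + N) ^ k] is the sum of ['C(k, i) N ^ i] over [i < d], because
    [N ^ d = 0], and ['C(k, i)] is a polynomial in [k] in characteristic 0. *)
Lemma power_curve d (N : 'M[K]_d) : strictly_lower N ->
  exists C : 'M[{poly K}]_d,
    forall k : nat, map_mx (horner_eval k%:R) C = (1 + N) ^+ k.
Proof.
move=> hN.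
pose b i : {poly K} := (i`!%:R^-1)%:P * \prod_(j < i) ('X - j%:R%:P).
have bE i k : (b i).[k%:R] = 'C(k, i)%:R.
  rewrite hornerM hornerC horner_prod.
  under eq_bigr do rewrite !hornerE.
  rewrite -natr_ffact -bin_ffact natrM mulrC mulfK // natrK.
  by rewrite -lt0n fact_gt0.
exists (\sum_(i < d) b i *: map_mx polyC (N ^+ i)) => k.
rewrite addrC exprD1n.
transitivity (\sum_(i < d) 'C(k, i)%:R *: N ^+ i).
  rewrite raddf_sum; apply: eq_bigr => i _.
  by apply/matrixP => x y; rewrite !mxE /= /horner_eval hornerM bE hornerC.
(* Both sums are extended to a common range: the terms added on one side vanish because
   [N ^+ i = 0], on the other because ['C(k, i) = 0]. *)
pose F i := 'C(k, i)%:R *: N ^+ i.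
transitivity (\sum_(i < maxn d k.+1) F i).
  rewrite (big_ord_widen _ F (leq_maxl d k.+1)) big_mkcond /=; apply: eq_bigr => i _.
  by case: ltnP => // di; rewrite /F strictly_lower_nilpotent ?scaler0.
rewrite (eq_bigr (fun i : 'I_k.+1 => F i)) => [|i _]; last by rewrite /F scaler_nat.
rewrite (big_ord_widen _ F (leq_maxr d k.+1)) big_mkcond /=.
symmetry; rewrite big_mkcond /=; apply: eq_bigr => i _.
by case: ltnP => // ki; rewrite /F bin_small ?scale0r.
Qed.

Section PowerCurve.
Variables (d : nat) (N : 'M[K]_d) (C : 'M[{poly K}]_d).
Hypothesis CE : forall k : nat, map_mx (horner_eval k%:R) C = (1 + N) ^+ k.

(** The identity [C(t) ^ q = C(q t)] holds at all natural [t], hence identically; it is evaluated at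
    [t = 1 / q]. *)
Lemma power_curve_root q : (0 < q)%N ->
  (map_mx (horner_eval q%:R^-1) C) ^+ q = 1 + N.
Proof.
move=> q0; have CC : C ^+ q = map_mx (comp_poly (q%:R *: 'X)) C.
  apply: mx_nat_inj => k; rewrite rmorphXn /= CE -exprM -CE.
  by apply/matrixP => i j; rewrite !mxE /= /horner_eval horner_comp !hornerE natrM mulrC.
rewrite -rmorphXn /= CC -[RHS]expr1 -CE; apply/matrixP => i j.
by rewrite !mxE /= /horner_eval horner_comp !hornerE divff // natrK -lt0n.
Qed.

(** The velocity at 0, which is the logarithm of [1 + N] when [C] interpolates its powers. *)
Definition curve_log : 'M[K]_d := \matrix_(i, j) (C i j)^`().[0].

(* For a natural number n, the curve satisfies C(n + t) = g^n C(t); differentiate at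
   t = 0. *)
Lemma curve_deriv : map_mx (@deriv K) C = C * map_mx polyC curve_log.
Proof.
apply: mx_nat_inj => n; rewrite rmorphM /= CE.
have Cn : map_mx (comp_poly ('X + n%:R%:P)) C = map_mx polyC ((1 + N) ^+ n) * C.
  apply: mx_nat_inj => k; rewrite rmorphM /= CE -[in RHS]map_mx_comp /=.
  rewrite [map_mx _ (_ ^+ n)]map_mx_id => [|x]; last by rewrite /= /horner_eval hornerC.
  rewrite -exprD -CE; apply/matrixP => i j.
  by rewrite !mxE /= /horner_eval horner_comp !hornerE natrD addrC.
apply/matrixP => i j; have /matrixP/(_ i j) := Cn.
rewrite !mxE => /(congr1 (fun P : {poly K} => P^`().[0])).
rewrite deriv_comp !derivE addr0 mulr1 horner_comp !hornerE /= => e.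
rewrite /horner_eval e.
rewrite linear_sum /= horner_sum; apply: eq_bigr => l _.
by rewrite !mxE /= /horner_eval mul_polyC derivZ hornerZ hornerC.
Qed.

(** The differential equation [C' = C L] gives [(k + 1) c_(k+1) = c_k L] for the coefficients,
    starting from [c_0 = 1]. *)
Lemma curve_coef k : map_mx (coefp k) C = k`!%:R^-1 *: curve_log ^+ k.
Proof.
elim: k => [|k IHk].
  rewrite fact0 invr1 scale1r expr0 -[RHS](expr0 (1 + N)) -CE.
  by apply/matrixP => i j; rewrite !mxE /= /horner_eval -horner_coef0.
have e : k.+1%:R *: map_mx (coefp k.+1) C = map_mx (coefp k) C * curve_log.
  have /(congr1 (map_mx (coefp k))) := curve_deriv => /matrixP e.
  apply/matrixP => i j; move: (e i j); rewrite !mxE /= coef_deriv mulr_natl => ->.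
  by rewrite coef_sum; apply: eq_bigr => l _; rewrite !mxE coefMC.
apply: (scalerI (_ : k.+1%:R != 0)); first by rewrite natrK.
rewrite e IHk exprSr -mulmxE -scalemxAl mulmxE scalerA factS natrM invfM mulrA divff ?mul1r //.
by rewrite natrK.
Qed.

End PowerCurve.

(** The curve [exp (t L)]; the truncation at [d] is exact for strictly lower [L]. *)
Definition exp_curve d (L : 'M[K]_d) : 'M[{poly K}]_d :=
  \sum_(i < d) (i`!%:R^-1 *: 'X^i) *: map_mx polyC (L ^+ i).

Lemma coef_exp_curve d (L : 'M[K]_d) k : strictly_lower L ->
  map_mx (coefp k) (exp_curve L) = k`!%:R^-1 *: L ^+ k.
Proof.
move=> hL; rewrite raddf_sum /=.
pose F i := if i == k then k`!%:R^-1 *: L ^+ k else 0.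
rewrite (eq_bigr (fun i : 'I_d => F i)) => [|i _]; last first.
  apply/matrixP => x y; rewrite /F !mxE /= coefMC coefZ coefXn eq_sym.
  by case: eqP => [->|_]; rewrite !mxE ?mulr1 // mulr0 mul0r.
rewrite /F; have [dk|kd] := leqP d k.
  rewrite strictly_lower_nilpotent // scaler0 big1 // => i _.
  by case: eqP => // ik; move: (ltn_ord i); rewrite ik ltnNge dk.
by rewrite -big_mkcond (big_pred1 (Ordinal kd)).
Qed.

Definition expm d (L : 'M[K]_d) : 'M[K]_d := \sum_(i < d) i`!%:R^-1 *: L ^+ i.

Lemma exp_curve_horner1 d (L : 'M[K]_d) :
  map_mx (horner_eval 1) (exp_curve L) = expm L.
Proof.
rewrite raddf_sum; apply: eq_bigr => i _; apply/matrixP => x y.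
by rewrite !mxE /= /horner_eval !hornerE expr1n mulr1.
Qed.

Lemma expm_curve_log d (N : 'M[K]_d) C :
    (forall k : nat, map_mx (horner_eval k%:R) C = (1 + N) ^+ k) ->
    strictly_lower (curve_log C) ->
  1 + N = expm (curve_log C).
Proof.
move=> CE hL; rewrite -exp_curve_horner1 -[LHS]expr1 -CE; congr map_mx.
apply/matrixP => i j; apply/polyP => k.
have /matrixP/(_ i j) := curve_coef CE k.
by rewrite -(coef_exp_curve k hL) !mxE.
Qed.

End PolynomialCurves.

(** * Dual numbers and the Lie algebra *)

(** The ring [A[e]] with [e ^ 2 = 0]: the pair [(a, b)] stands for [a + b e]. A separate name keeps
    its product apart from the componentwise one. *)
Definition dual (A : Type) : Type := (A * A)%type.

Section DualNumbers.
Variable A : comNzRingType.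
Implicit Types x y z : dual A.

HB.instance Definition _ := GRing.Zmodule.copy (dual A) (A * A)%type.

Definition dual_one : dual A := (1, 0).
Definition dual_mul x y : dual A := (x.1 * y.1, x.1 * y.2 + x.2 * y.1).

Let dual_eq x y : x.1 = y.1 -> x.2 = y.2 -> x = y.
Proof. by case: x y => [? ?] [? ?] /= -> ->. Qed.

Lemma dual_mulA : associative dual_mul.
Proof.
move=> x y z; apply: dual_eq; rewrite /= ?mulrA //.
by rewrite mulrDr mulrDl !mulrA addrA.
Qed.

Lemma dual_mulC : commutative dual_mul.
Proof.
move=> x y; apply: dual_eq; rewrite /= ?[x.1 * _]mulrC //.
by rewrite addrC [x.2 * _]mulrC.
Qed.

Lemma dual_mul1 : left_id dual_one dual_mul.
Proof. by move=> x; apply: dual_eq; rewrite /= ?mul0r ?mul1r ?addr0. Qed.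

Lemma dual_mulDl : left_distributive dual_mul +%R.
Proof.
move=> x y z; apply: dual_eq; rewrite /= mulrDl //.
by rewrite mulrDl addrACA.
Qed.

Lemma dual_one_neq0 : dual_one != 0.
Proof. by apply/eqP => -[/eqP]; rewrite oner_eq0. Qed.

HB.instance Definition _ := GRing.Zmodule_isComNzRing.Build (dual A)
  dual_mulA dual_mulC dual_mul1 dual_mulDl dual_one_neq0.

Definition dual_const (a : A) : dual A := (a, 0).

Lemma dual_const_zmod : zmod_morphism dual_const.
Proof. by move=> a b; apply: dual_eq; rewrite /= ?subr0. Qed.

Lemma dual_const_monoid : monoid_morphism dual_const.
Proof. by split=> // a b; apply: dual_eq; rewrite /= ?mulr0 ?mul0r ?addr0. Qed.

HB.instance Definition _ := GRing.isZmodMorphism.Build A (dual A) dual_const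
  dual_const_zmod.
HB.instance Definition _ := GRing.isMonoidMorphism.Build A (dual A) dual_const
  dual_const_monoid.

Lemma dual_sum (I : Type) (r : seq I) (P : pred I) (F : I -> dual A) :
  \sum_(i <- r | P i) F i =
  (\sum_(i <- r | P i) (F i).1, \sum_(i <- r | P i) (F i).2) :> dual A.
Proof. by elim/big_rec3: _ => // i a b _ _ ->. Qed.

End DualNumbers.

Section DualMap.
Variables (A B : comNzRingType) (f : {rmorphism A -> B}).

Definition dual_map (x : dual A) : dual B := (f x.1, f x.2).

Lemma dual_map_zmod : zmod_morphism dual_map.
Proof. by move=> x y; rewrite /dual_map !rmorphB. Qed.

Lemma dual_map_monoid : monoid_morphism dual_map.
Proof.
split=> [|x y]; first by rewrite /dual_map rmorph1 rmorph0.
by rewrite /dual_map rmorphM rmorphD !rmorphM.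
Qed.

HB.instance Definition _ := GRing.isZmodMorphism.Build (dual A) (dual B) dual_map
  dual_map_zmod.
HB.instance Definition _ := GRing.isMonoidMorphism.Build (dual A) (dual B) dual_map
  dual_map_monoid.

End DualMap.

Section Jet.
Variables (K B : comNzRingType) (f : {rmorphism {poly K} -> B}).

(** The first-order expansion [f(P) + f(P') e], multiplicative by the Leibniz rule. Iterated, it
    reaches the higher derivatives. *)
Definition jet (P : {poly K}) : dual B := (f P, f P^`()).

Lemma jet_zmod : zmod_morphism jet.
Proof. by move=> P Q; rewrite /jet derivB !rmorphB. Qed.

Lemma jet_monoid : monoid_morphism jet.
Proof.
split=> [|P Q]; first by rewrite /jet derivC rmorph1 rmorph0.
by rewrite /jet derivM rmorphM rmorphD !rmorphM addrC.
Qed.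

HB.instance Definition _ := GRing.isZmodMorphism.Build {poly K} (dual B) jet jet_zmod.
HB.instance Definition _ := GRing.isMonoidMorphism.Build {poly K} (dual B) jet
  jet_monoid.

End Jet.

(** * Points of G, its Lie algebra and the exponential *)

Section Points.
Variables (d : nat) (G : unipotent_Zgroup d).

Lemma eval_entries_map (A B : comNzRingType) (f : {rmorphism A -> B})
    (M : 'M[A]_d) (g : {mpoly int[d * d]}) :
  eval_entries (map_mx f M) g = f (eval_entries M g).
Proof.
rewrite /eval_entries /mmap rmorph_sum; apply: eq_bigr => m _.
rewrite rmorphM rmorph_int /mmap1 rmorph_prod; congr (_ * _).
by apply: eq_bigr => i _; rewrite rmorphXn -map_mxvec mxE.
Qed.

Lemma points_map (A B : comNzRingType) (f : {rmorphism A -> B}) (M : 'M[A]_d) :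
  points G A M -> points G B (map_mx f M).
Proof.
move=> [[/is_trig_mxP Mt M1] Me]; split; last first.
  by move=> g Ig; rewrite eval_entries_map Me ?rmorph0.
split; last by move=> i; rewrite mxE M1 rmorph1.
by apply/is_trig_mxP => i j ij; rewrite mxE Mt ?rmorph0.
Qed.

Lemma points_map_inj (A B : comNzRingType) (f : {rmorphism A -> B}) (M : 'M[A]_d) :
  injective f -> points G B (map_mx f M) -> points G A M.
Proof.
move=> fI [[/is_trig_mxP Mt M1] Me]; split; last first.
  by move=> g /Me; rewrite eval_entries_map -(rmorph0 f) => /fI.
split; last by move=> i; apply: fI; rewrite rmorph1 -(M1 i) mxE.
by apply/is_trig_mxP => i j ij; apply: fI; rewrite rmorph0 -(Mt i j ij) mxE.
Qed.

Lemma points_strictly_lower (A : comNzRingType) (M : 'M[A]_d) :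
  points G A M -> strictly_lower (M - 1%:M).
Proof.
move=> [[/is_trig_mxP Mt M1] _] i j; rewrite leq_eqVlt => /predU1P[/val_inj ij|ij].
  by rewrite ij !mxE M1 eqxx subrr.
by rewrite !mxE Mt // -val_eqE ltn_eqF ?subr0.
Qed.

Definition dual_mx (A : comNzRingType) (X : 'M[A]_d) : 'M[dual A]_d :=
  \matrix_(i, j) ((1%:M : 'M[A]_d) i j, X i j).

(** The tangent space of [G] at the identity: [1 + e X] is a point over the dual numbers. *)
Definition lie (A : comNzRingType) (X : 'M[A]_d) : Prop :=
  points G (dual A) (dual_mx X).

Lemma lie_strictly_lower (A : comNzRingType) (X : 'M[A]_d) :
  lie X -> strictly_lower X.
Proof.
move=> [[/is_trig_mxP Mt M1] _] i j; rewrite leq_eqVlt => /predU1P[/val_inj ij|ij].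
  by have := M1 i; rewrite ij mxE => -[].
by have := Mt i j ij; rewrite mxE => -[].
Qed.

Section CharacteristicZero.
Variable K : fieldType.
Hypothesis K0 : [pchar K] =i pred0.

Lemma exp_curve_deriv (L : 'M[K]_d) : strictly_lower L ->
  map_mx (@deriv K) (exp_curve L) = exp_curve L * map_mx polyC L.
Proof.
move=> hL; apply/matrixP => i j; apply/polyP => k.
have /matrixP/(_ i j) := coef_exp_curve k.+1 hL.
rewrite !mxE /= coef_deriv => ->.
transitivity ((k`!%:R^-1 *: L ^+ k *m L) i j); last first.
  rewrite -(coef_exp_curve k hL) mxE coef_sum; apply: eq_bigr => l _.
  by rewrite !mxE coefMC.
rewrite -scalemxAl mulmxE -exprSr !mxE -mulrnAl; congr (_ * _).
rewrite factS natrM invfM -mulr_natl mulrA divff ?mul1r //.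
by have /pcharf0P -> := K0.
Qed.

(* If the curve is in G after f, it is in G after jet f, because its derivative is its
   product by X. Starting from the evaluation at 0 this yields all Taylor
   coefficients of its defining equations. *)
Lemma exp_curve_points (X : 'M[K]_d) : lie X -> points G {poly K} (exp_curve X).
Proof.
move=> lX; have hX := lie_strictly_lower lX; set E := exp_curve X.
have jets n : exists (B : comNzRingType) (f : {rmorphism {poly K} -> B}),
    points G B (map_mx f E) /\
    forall P, f P = 0 -> forall k, (k <= n)%N -> P^`(k).[0] = 0.
  elim: n => [|n [B [f [fE fP]]]].
    exists K, (horner_eval 0); split=> [|P P0 k]; last by rewrite leqn0 => /eqP ->.
    suff -> : map_mx (horner_eval 0) E = 1%:M by exact: points_one.
    have := coef_exp_curve 0 hX; rewrite fact0 invr1 scale1r expr0 => e; rewrite -[RHS]e.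
    by apply/matrixP => i j; rewrite !mxE /= /horner_eval horner_coef0.
  exists (dual B), (jet f); split.
    suff -> : map_mx (jet f) E =
        map_mx (@dual_const B) (map_mx f E) *m
        map_mx (dual_map (f \o polyC)) (dual_mx X).
      by apply: points_mul; exact: points_map.
    apply/matrixP => i j; rewrite !mxE.
    have /matrixP/(_ i j) := exp_curve_deriv hX.
    rewrite mxE => e; rewrite /jet e -/E.
    under eq_bigr do rewrite !mxE.
    rewrite dual_sum; congr pair; last first.
      rewrite mxE rmorph_sum; apply: eq_bigr => l _.
      by rewrite mxE rmorphM /= mul0r addr0.
    rewrite (bigD1 j) //= eqxx rmorph1 mulr1 big1 ?addr0 // => l /negPf lj.
    by rewrite lj !rmorph0 mulr0.
  move=> P [fP0 fP'0] [|k]; first by move=> _; exact: fP.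
  by rewrite ltnS derivSn; exact: fP.
(* A polynomial killed by all these morphisms has all its derivatives 0 at 0, so it is 0 in
   characteristic 0. This is then applied to each condition defining [G]. *)
have E0 P : (forall (B : comNzRingType) (f : {rmorphism {poly K} -> B}),
    points G B (map_mx f E) -> f P = 0) -> P = 0.
  move=> fP0; apply/polyP => k; have [B [f [fE fP]]] := jets k.
  have := fP _ (fP0 _ _ fE) _ (leqnn k).
  rewrite horner_coef0 coef_derivn addn0 ffactnn coef0 => /eqP.
  have /pcharf0P nK := K0.
  by rewrite -mulr_natr mulf_eq0 nK eqn0Ngt fact_gt0 orbF => /eqP.
split; last first.
  by move=> g Ig; apply: E0 => B f [_ /(_ _ Ig)]; rewrite eval_entries_map.
split=> [|i].
  apply/is_trig_mxP => i j ij; apply: E0 => B f [[/is_trig_mxP Et _] _].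
  by rewrite -(Et i j ij) mxE.
apply/eqP; rewrite -subr_eq0; apply/eqP/E0 => B f [[_ E1] _].
by rewrite rmorphB rmorph1 -(E1 i) mxE subrr.
Qed.

Lemma expm_points (X : 'M[K]_d) : lie X -> points G K (expm X).
Proof.
by move=> /exp_curve_points/(points_map (horner_eval 1)); rewrite exp_curve_horner1.
Qed.

(** Each defining condition, taken on [C], is a polynomial identity in the parameter which holds at
    all natural numbers because the powers of [g] lie in [G]. *)
Lemma power_curve_points (g : 'M[K]_d) C : points G K g ->
    (forall k : nat, map_mx (horner_eval k%:R) C = g ^+ k) ->
  points G {poly K} C.
Proof.
move=> gG CE; have Ck k : points G K (map_mx (horner_eval k%:R) C).
  rewrite CE; elim: k => [|k IHk]; first exact: points_one.
  by rewrite exprS; apply: points_mul.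
split; last first.
  move=> f If; apply: (poly_nat_inj K0) => k; rewrite horner0.
  by have [_ /(_ f If)] := Ck k; rewrite eval_entries_map.
split=> [|i].
  apply/is_trig_mxP => i j ij; apply: (poly_nat_inj K0) => k.
  by have [[/is_trig_mxP Ct _] _] := Ck k; rewrite horner0 -(Ct i j ij) mxE.
apply: (poly_nat_inj K0) => k.
by have [[_ C1] _] := Ck k; rewrite hornerC; have := C1 i; rewrite mxE.
Qed.

Lemma points_curve (g : 'M[K]_d) : points G K g -> exists2 C : 'M[{poly K}]_d,
  points G {poly K} C & forall k : nat, map_mx (horner_eval k%:R) C = g ^+ k.
Proof.
move=> gG; have [C CE] := power_curve K0 (points_strictly_lower gG).
have {}CE k : map_mx (horner_eval k%:R) C = g ^+ k.
  by rewrite CE; congr (_ ^+ _); rewrite addrC; apply: subrK.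
by exists C => //; apply: power_curve_points CE.
Qed.

Lemma points_root (g : 'M[K]_d) q : (0 < q)%N -> points G K g ->
  exists2 r, points G K r & r ^+ q = g.
Proof.
move=> q0 /points_curve[C CG CE]; exists (map_mx (horner_eval q%:R^-1) C).
  exact: points_map.
rewrite (@power_curve_root _ K0 _ (g - 1)) // => [|k]; first by rewrite addrC subrK.
by rewrite CE addrC subrK.
Qed.

(** The jet at 0 of the curve through the powers of [g] is [1 + e L] with [L = C'(0)], which puts
    [L] in the Lie algebra. *)
Lemma points_log (g : 'M[K]_d) : points G K g -> exists2 L, lie L & g = expm L.
Proof.
move=> /points_curve[C CG CE]; pose L := curve_log C.
have LL : lie L.
  have /(points_map (jet (horner_eval 0))) := CG; rewrite /lie; congr points.
  apply/matrixP => i j; rewrite !mxE /= /jet; congr pair.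
  by have /matrixP/(_ i j) := CE 0; rewrite !mxE.
have e : g = 1 + (g - 1) by rewrite addrC subrK.
exists L => //; rewrite e; apply: (expm_curve_log K0); last exact: lie_strictly_lower.
by move=> k; rewrite -e.
Qed.

End CharacteristicZero.
End Points.

(** * Integral linear equations of the Lie algebra *)

Section LinearEquations.

(** The expansion [f(a + e x) = f(a) + e df_a(x)], whose differential has integer coefficients
    independent of [A]. The polynomials with this property include constants and variables and are
    stable under sums and products. *)
Lemma mmap_dual n (a : 'I_n -> int) (f : {mpoly int[n]}) :
  exists (v : int) (c : 'rV[int]_n), forall (A : comNzRingType) (x : 'I_n -> A),
    mmap intr (fun i => ((a i)%:~R, x i) : dual A) f =
    (v%:~R, \sum_i (c 0 i)%:~R * x i) :> dual A.
Proof.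
pose L (f : {mpoly int[n]}) := exists (v : int) (c : 'rV[int]_n),
  forall (A : comNzRingType) (x : 'I_n -> A),
    mmap intr (fun i => ((a i)%:~R, x i) : dual A) f =
    (v%:~R, \sum_i (c 0 i)%:~R * x i) :> dual A.
have L0 v : L v%:MP.
  exists v, 0 => A x; rewrite mmapC.
  transitivity (@dual_const A v%:~R); first by rewrite rmorph_int.
  by congr pair; rewrite big1 // => i _; rewrite mxE mul0r.
have LD f1 f2 : L f1 -> L f2 -> L (f1 + f2).
  move=> [v [c h]] [v' [c' h']]; exists (v + v'), (c + c') => A x.
  rewrite mmapD h h'; congr pair; first by rewrite /= rmorphD.
  by rewrite -big_split /=; apply: eq_bigr => i _; rewrite mxE rmorphD mulrDl.
have LM f1 f2 : L f1 -> L f2 -> L (f1 * f2).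
  move=> [v [c h]] [v' [c' h']]; exists (v * v'), (v *: c' + v' *: c) => A x.
  rewrite rmorphM /= h h'; congr pair; first by rewrite /= rmorphM.
  rewrite /= mulr_sumr mulr_suml -big_split /=; apply: eq_bigr => i _.
  by rewrite !mxE rmorphD !rmorphM mulrDl mulrA; congr (_ + _); rewrite mulrC mulrA.
have LX i : L 'X_i.
  exists (a i), (delta_mx 0 i) => A x; rewrite mmapX mmap1U; congr pair.
  rewrite (bigD1 i) //= mxE !eqxx mul1r big1 ?addr0 // => j /negPf ji.
  by rewrite mxE ji andbF mul0r.
have L1 : L 1 by rewrite -mpolyC1; exact: L0.
elim/mpolyind: f => [|c m p _ _ Lp]; first by rewrite -mpolyC0; exact: L0.
apply: (LD) => //; rewrite -mul_mpolyC; apply: (LM) => //.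
rewrite mpolyXE_id; apply: (big_ind L) => [|f1 f2|i _]; [exact: L1|exact: LM|].
by elim: (m i) => [|k IHk]; rewrite ?expr0 // exprS; apply: LM.
Qed.

Variables (d : nat) (G : unipotent_Zgroup d).

(** The equations are the differentials at the identity of the equations of [G], together with the
    coordinates on and above the diagonal. *)
Lemma lie_linear : exists S : set 'rV[int]_(d * d),
  forall (A : comNzRingType) (X : 'M[A]_d),
    lie G X <-> forall c, S c -> \sum_i (c 0 i)%:~R * mxvec X 0 i = 0.
Proof.
have [c cE] : exists c : {mpoly int[d * d]} -> 'rV[int]_(d * d),
    forall f, equations G f -> forall (A : comNzRingType) (X : 'M[A]_d),
    eval_entries (dual_mx X) f = (0, \sum_i (c f 0 i)%:~R * mxvec X 0 i) :> dual A.
  pose e i : int := mxvec (1%:M : 'M[int]_d) 0 i.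
  have /choice[c cE] := fun f => mmap_dual e f.
  have /choice[c' c'E] := cE.
  exists c' => f If A X.
  have eE (X' : 'M[A]_d) : eval_entries (dual_mx X') f =
      ((c f)%:~R, \sum_i (c' f 0 i)%:~R * mxvec X' 0 i) :> dual A.
    rewrite -c'E /eval_entries /mmap; apply: eq_bigr => m _; congr (_ * _).
    apply: eq_bigr => i _; congr (_ ^+ _); case/mxvec_indexP: i => i j.
    by rewrite /e !mxvecE !mxE rmorph_nat.
  (* The constant term is 0 because the identity matrix, the case [X = 0], satisfies the
     equation. *)
  rewrite eE; congr pair; have [_ /(_ _ If)] := points_one G (dual A).
  suff <- : dual_mx (0 : 'M[A]_d) = 1%:M by rewrite eE => -[].
  by apply/matrixP => i j; rewrite !mxE; case: (i == j).
exists ([set delta_mx 0 (mxvec_index ij.1 ij.2) |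
           ij in [set ij : 'I_d * 'I_d | (ij.1 <= ij.2)%N]] `|`
        [set c f | f in equations G]) => A X.
have deltaE (i j : 'I_d) :
    \sum_l ((delta_mx 0 (mxvec_index i j) : 'rV[int]_(d * d)) 0 l)%:~R *
      mxvec X 0 l = X i j.
  rewrite (bigD1 (mxvec_index i j)) //= mxE !eqxx mul1r mxvecE big1 ?addr0 //.
  by move=> l /negPf lij; rewrite mxE lij andbF mul0r.
split.
  move=> LX _ [[[i j] /= ij <-]|[f If <-]].
    by rewrite deltaE (lie_strictly_lower LX).
  by have [_ /(_ _ If)] := LX; rewrite cE // => -[].
move=> SX; have X0 (i j : 'I_d) : (i <= j)%N -> X i j = 0.
  by move=> ij; rewrite -deltaE; apply: SX; left; exists (i, j).
split; last by move=> f If; rewrite cE // SX //; right; exists f.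
split=> [|i]; last by rewrite mxE X0 // mxE eqxx.
apply/is_trig_mxP => i j ij; rewrite mxE X0 1?ltnW // mxE.
by rewrite -val_eqE ltn_eqF.
Qed.

(* The Lie algebra is the kernel of a matrix with integer entries, and computing the
   kernel commutes with extending the field. *)
Lemma lie_span : exists B : 'M[rat]_(d * d),
  (forall x : 'rV_(d * d), lie G (vec_mx (x *m B))) /\
  forall (K : fieldType) (f : {rmorphism rat -> K}) (X : 'M[K]_d),
    lie G X -> exists y : 'rV_(d * d), mxvec X = y *m map_mx f B.
Proof.
have [S SE] := lie_linear.
(* The set [S] may be infinite; a finite family [C] of its equations with maximal rank spans all of
   them over [rat]. *)
pose Q r := `[< exists m (C : 'M[int]_(m, d * d)), (forall i, S (row i C)) /\
   \rank (map_mx intr C : 'M[rat]_(m, d * d)) = r >].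
have Q0 : exists r, Q r.
  exists 0%N; apply/asboolP; exists 0%N, 0; split; first by case.
  by rewrite map_mx0 mxrank0.
have Qd r : Q r -> (r <= d * d)%N.
  by move=> /asboolP[m [C [_ <-]]]; exact: rank_leq_col.
have [r /asboolP[m [C [SC rC]]] rmax] := ex_maxnP Q0 Qd.
pose CQ : 'M[rat]_(m, d * d) := map_mx intr C.
exists (kermx CQ^T).
have lin (A : comNzRingType) (c : 'rV[int]_(d * d)) (x : 'rV[A]_(d * d)) :
    \sum_i (c 0 i)%:~R * x 0 i = (x *m (map_mx intr c)^T) 0 0.
  by rewrite mxE; apply: eq_bigr => i _; rewrite !mxE mulrC.
split=> [x|K f X LX].
  apply/SE => c Sc; rewrite vec_mxK lin.
  have /submxP[a ->] : (map_mx intr c <= CQ)%MS.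
    have := rmax (\rank (col_mx CQ (map_mx intr c))).
    rewrite -rC -/CQ => rankCc.
    suff : (col_mx CQ (map_mx intr c) <= CQ)%MS by rewrite col_mx_sub => /andP[].
    have CCc : (CQ <= col_mx CQ (map_mx intr c))%MS by rewrite -addsmxE addsmxSl.
    rewrite -(mxrank_leqif_sup CCc) eqn_leq mxrankS //= rankCc //.
    apply/asboolP; exists (m + 1)%N, (col_mx C c); rewrite map_col_mx; split=> // i.
    by case: (split_ordP i) => j ->; rewrite ?rowKu ?rowKd // ord1 row_id.
  by rewrite trmx_mul mulmxA -(mulmxA x) mulmx_ker mulmx0 mul0mx mxE.
have /submxP[y ->] : (mxvec X <= map_mx f (kermx CQ^T))%MS; last by exists y.
rewrite map_kermx; apply/sub_kermxP/rowP => i.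
have Si := (SE _ _).1 LX _ (SC i); rewrite [RHS]mxE -[RHS]Si mxE.
apply: eq_bigr => j _. rewrite mulrC; congr (_ * _). 
by rewrite !mxE rmorph_int.
Qed.

End LinearEquations.

(** * Entries of roots of unipotent matrices *)

Section RootEntries.
Variables (K : fieldType) (d : nat) (V : nat -> set K) (q : nat).
Hypothesis V0 : forall i, V i 0.
Hypothesis VD : forall i x y, V i x -> V i y -> V i (x + y).
Hypothesis VN : forall i x, V i x -> V i (- x).
Hypothesis VM : forall i x y, V i x -> V i y -> V i (x * y).
Hypothesis VS : forall i x, V i x -> V i.+1 x.
Hypothesis Vq : forall i x, (i < d)%N -> V i (q%:R * x) -> V i.+1 x.

Let VMn i x n : V i x -> V i (x *+ n).
Proof. by move=> Vx; elim: n => [|n]; rewrite ?mulr0n // mulrS; exact: VD. Qed.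

(* By induction on the distance to the diagonal: the entries of
   (1 + N) ^ q - 1 and of q N differ by polynomials in the entries of N which are
   closer to the diagonal. *)
Lemma root_entries (N : 'M[K]_d) : (0 < q)%N -> strictly_lower N ->
  (forall a b, V 0 (((1 + N) ^+ q - 1) a b)) ->
  forall a b : 'I_d, V (a - b) (N a b).
Proof.
move=> q0 hN VNq a b.
have Vsum k (I : finType) (F : I -> K) : (forall i, V k (F i)) -> V k (\sum_i F i).
  by move=> VF; elim/big_ind: _ => // *; exact: VD.
suff VNk k : (k < d)%N -> forall a b : 'I_d, (a <= b + k)%N -> V k (N a b).
  by apply: VNk; have := ltn_ord a; lia.
elim: k => {a b} [|k IHk] kd a b ab; first by rewrite hN //; lia.
have {}IHk := IHk (ltnW kd).
(* In a product of at least two strictly lower factors, an entry at distance [k.+1] from the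
   diagonal only involves entries of each factor at distance at most [k]. *)
have Nexp i : (forall a b : 'I_d, (a <= b + k)%N -> V k ((N ^+ i.+1) a b)) /\
    forall a b : 'I_d, (a <= b + k.+1)%N -> V k ((N ^+ i.+2) a b).
  elim: i => [|i [IHi1 IHi2]]; split=> {ab}a {}b ab.
  - by rewrite expr1; exact: IHk.
  - rewrite expr2 mxE; apply: Vsum => c.
    have [ac|ca] := leqP a c; first by rewrite hN ?mul0r.
    have [cb|bc] := leqP c b; first by rewrite [N c b]hN ?mulr0.
    by apply: VM; apply: IHk; lia.
  - by apply: IHi2; lia.
  - rewrite exprS mxE; apply: Vsum => c.
    have [ac|ca] := leqP a c; first by rewrite hN ?mul0r.
    have [cb|bc] := leqP c b.
      by rewrite exp_strictly_lower ?mulr0 //; lia.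
    apply: VM; first by apply: IHk; lia.
    by apply: IHi2; lia.
apply: Vq; first exact: ltnW.
have e : (1 + N) ^+ q - 1 = q%:R *: N + \sum_(i < q.-1) N ^+ i.+2 *+ 'C(q, i.+2).
  rewrite [1 + N]addrC exprD1n; case: q q0 => // q' _.
  rewrite 2!big_ord_recl /= expr0 bin0 expr1 bin1 mulr1n addrAC addrN add0r.
  by rewrite scaler_nat.
have V0k x : V 0 x -> V k x by move=> V0x; elim: (k) => // n; exact: VS.
have := V0k _ (VNq a b); rewrite e 2!mxE summxE.
set S := \sum_(i < _) _ => h; rewrite -[_ * _](addrK S).
apply: VD => //; apply: VN; apply: Vsum => i.
by rewrite mulmxnE; apply: VMn; have [_] := Nexp i; apply; lia.
Qed.

End RootEntries.

(** * Multiples of powers of p, and fractions with p-power denominators *)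

Section Lattice.
Variables (O : comNzRingType) (K : fieldType) (f : {rmorphism O -> K}).
Variable (p : nat).
Hypothesis p0 : (p%:R : K) != 0.

Definition pmul (n : nat) : set K := [set x | exists z, x = p%:R ^+ n * f z].

(** The image of [O[1/p]] in [K]. *)
Definition inv_p : set K := [set x | exists n, pmul 0 (p%:R ^+ n * x)].

Lemma pmul_0 n : pmul n 0.
Proof. by exists 0; rewrite rmorph0 mulr0. Qed.

Lemma pmul_D n x y : pmul n x -> pmul n y -> pmul n (x + y).
Proof. by move=> [a ->] [b ->]; exists (a + b); rewrite rmorphD mulrDr. Qed.

Lemma pmul_N n x : pmul n x -> pmul n (- x).
Proof. by move=> [a ->]; exists (- a); rewrite rmorphN mulrN. Qed.

Lemma pmul_B n x y : pmul n x -> pmul n y -> pmul n (x - y).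
Proof. by move=> Vx Vy; apply: pmul_D => //; exact: pmul_N. Qed.

Lemma pmul_M m n x y : pmul m x -> pmul n y -> pmul (m + n) (x * y).
Proof.
by move=> [a ->] [b ->]; exists (a * b); rewrite rmorphM exprD mulrACA.
Qed.

Lemma pmul_le m n x : (m <= n)%N -> pmul n x -> pmul m x.
Proof.
move=> mn [a ->]; exists (p%:R ^+ (n - m) * a).
by rewrite rmorphM rmorphXn rmorph_nat mulrA -exprD subnKC.
Qed.

Lemma pmul_sum n (I : Type) (r : seq I) (P : pred I) (F : I -> K) :
  (forall i, P i -> pmul n (F i)) -> pmul n (\sum_(i <- r | P i) F i).
Proof.
by move=> VF; elim/big_rec: _ => [|i x Pi]; [exact: pmul_0|apply: pmul_D; exact: VF].
Qed.

Lemma pmul_pM m n x : pmul (m + n) (p%:R ^+ m * x) <-> pmul n x.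
Proof.
split=> -[a e]; exists a; last by rewrite e exprD mulrA.
by apply: (mulfI (expf_neq0 m p0)); rewrite e exprD mulrA.
Qed.

Lemma pmul0_f z : pmul 0 (f z). Proof. by exists z; rewrite mul1r. Qed.

Lemma pmul0_nat n : pmul 0 n%:R.
Proof. by rewrite -(rmorph_nat f); exact: pmul0_f. Qed.

Lemma inv_p_pmul0 x : pmul 0 x -> inv_p x.
Proof. by move=> Vx; exists 0%N; rewrite mul1r. Qed.

Lemma inv_p_D x y : inv_p x -> inv_p y -> inv_p (x + y).
Proof.
have lift m x' n : (m <= n)%N -> pmul 0 (p%:R ^+ m * x') -> pmul 0 (p%:R ^+ n * x').
  move=> mn h; rewrite -(subnK mn) exprD -mulrA -natrX.
  exact: (@pmul_M 0 0 _ _ (pmul0_nat _) h).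
move=> [m hm] [n hn]; exists (maxn m n); rewrite mulrDr.
by apply: pmul_D; [exact: lift (leq_maxl _ _) hm|exact: lift (leq_maxr _ _) hn].
Qed.

Lemma inv_p_N x : inv_p x -> inv_p (- x).
Proof. by move=> [n h]; exists n; rewrite mulrN; exact: pmul_N. Qed.

Lemma inv_p_M x y : inv_p x -> inv_p y -> inv_p (x * y).
Proof.
move=> [m hm] [n hn]; exists (m + n)%N; rewrite exprD mulrACA.
exact: (@pmul_M 0 0 _ _ hm hn).
Qed.

Lemma inv_p_pM n x : inv_p (p%:R ^+ n * x) -> inv_p x.
Proof. by move=> [m h]; exists (m + n)%N; rewrite exprD -mulrA. Qed.

Lemma inv_p_sum (I : Type) (r : seq I) (P : pred I) (F : I -> K) :
  (forall i, P i -> inv_p (F i)) -> inv_p (\sum_(i <- r | P i) F i).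
Proof.
move=> VF; elim/big_rec: _ => [|i x Pi]; last by apply: inv_p_D; exact: VF.
exact: (inv_p_pmul0 (pmul_0 0)).
Qed.

Section Matrices.
Variables (d : nat).

Definition pmul_mx m n k (M : 'M[K]_(m, n)) : Prop := forall i j, pmul k (M i j).
Definition inv_p_mx m n (M : 'M[K]_(m, n)) : Prop := forall i j, inv_p (M i j).

Lemma pmul_mxB m n k (M N : 'M[K]_(m, n)) :
  pmul_mx k M -> pmul_mx k N -> pmul_mx k (M - N).
Proof. by move=> hM hN i j; rewrite !mxE; exact: pmul_B. Qed.

Lemma pmul_mxD m n k (M N : 'M[K]_(m, n)) :
  pmul_mx k M -> pmul_mx k N -> pmul_mx k (M + N).
Proof. by move=> hM hN i j; rewrite !mxE; exact: pmul_D. Qed.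

Lemma pmul_mxM m n l k k' (M : 'M[K]_(m, n)) (N : 'M[K]_(n, l)) :
  pmul_mx k M -> pmul_mx k' N -> pmul_mx (k + k') (M *m N).
Proof. by move=> hM hN i j; rewrite !mxE; apply: pmul_sum => *; exact: pmul_M. Qed.

Lemma pmul_mx_le m n k k' (M : 'M[K]_(m, n)) :
  (k <= k')%N -> pmul_mx k' M -> pmul_mx k M.
Proof. by move=> kk hM i j; exact: pmul_le (hM i j). Qed.

Lemma pmul_mx1 : pmul_mx 0 (1%:M : 'M[K]_d).
Proof. by move=> i j; rewrite mxE; exact: pmul0_nat. Qed.

Lemma inv_p_mxM m n l (M : 'M[K]_(m, n)) (N : 'M[K]_(n, l)) :
  inv_p_mx M -> inv_p_mx N -> inv_p_mx (M *m N).
Proof. by move=> hM hN i j; rewrite !mxE; apply: inv_p_sum => *; exact: inv_p_M. Qed.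

(** The filtration in [root_entries] is constant here, since [O[1/p]] is stable under division by
    [p ^ m]. *)
Lemma root_inv_p (r : 'M[K]_d) m : strictly_lower (r - 1%:M) ->
  inv_p_mx (r ^+ (p ^ m)) -> inv_p_mx r.
Proof.
move=> hr hrq; have e : r = 1 + (r - 1%:M) by rewrite addrC; symmetry; exact: subrK.
have V1 i j : inv_p ((1%:M : 'M[K]_d) i j) by exact: inv_p_pmul0 (pmul_mx1 i j).
have q0 : (0 < p ^ m)%N.
  by rewrite expn_gt0; case: (p) p0 => //; rewrite eqxx.
have h i j : inv_p ((r - 1%:M) i j).
  apply: (@root_entries _ _ (fun=> inv_p) (p ^ m)%N) => //.
  - by move=> _; exact: inv_p_pmul0 (pmul_0 0).
  - by move=> _ x y; exact: inv_p_D.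
  - by move=> _ x; exact: inv_p_N.
  - by move=> _ x y; exact: inv_p_M.
  - by move=> _ x _; rewrite natrX; exact: inv_p_pM.
  - move=> a b; rewrite -e !mxE; apply: inv_p_D; first exact: hrq.
    by apply: inv_p_N; exact: inv_p_pmul0 (pmul0_nat _).
by move=> i j; rewrite e mxE; apply: inv_p_D.
Qed.

(** Each step away from the diagonal costs one division by [p ^ m], and there are fewer than [d]
    steps; hence the exponent [n + d * m]. *)
Lemma root_pmul (r : 'M[K]_d) m n : strictly_lower (r - 1%:M) ->
  pmul_mx (n + d * m) (r ^+ (p ^ m) - 1%:M) -> pmul_mx n (r - 1%:M).
Proof.
move=> hr hrq; have e : r = 1 + (r - 1%:M) by rewrite addrC; symmetry; exact: subrK.
have q0 : (0 < p ^ m)%N.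
  by rewrite expn_gt0; case: (p) p0 => //; rewrite eqxx.
pose V i := pmul (n + d * m - i * m)%N.
have h (i j : 'I_d) : V (i - j)%N ((r - 1%:M) i j).
  apply: (@root_entries _ _ V (p ^ m)%N) => //.
  - by move=> k; exact: pmul_0.
  - by move=> k x y; exact: pmul_D.
  - by move=> k x; exact: pmul_N.
  - by move=> k x y Vx Vy; exact: pmul_le (leq_addr _ _) (pmul_M Vx Vy).
  - by move=> k x; apply: pmul_le; lia.
  - move=> k x kd; rewrite /V natrX.
    by rewrite (_ : _ - _ = m + (n + d * m - k.+1 * m))%N ?pmul_pM //; nia.
  - by move=> a b; rewrite -e /V subn0; exact: hrq.
by move=> i j; apply: pmul_le (h i j); have := ltn_ord i; nia.
Qed.

End Matrices.
End Lattice.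

(** * The p-adic numbers *)

Section RatrChar0.
Variable K : fieldType.
Hypothesis K0 : [pchar K] =i pred0.

Lemma intr_eq0_pchar0 (n : int) : (n%:~R == 0 :> K) = (n == 0).
Proof. by have /pcharf0P nK := K0; case: n => n; rewrite ?NegzE ?rmorphN ?oppr_eq0 /= nK. Qed.

Lemma ratr_frac_pchar0 (n m : int) : m != 0 ->
  ratr (n%:~R / m%:~R) = n%:~R / m%:~R :> K.
Proof.
move=> m0; set x := _ / _ : rat; have mQ : m%:~R != 0 :> rat by rewrite intr_eq0.
have mK : m%:~R != 0 :> K by rewrite intr_eq0_pchar0.
have dK : (denq x)%:~R != 0 :> K by rewrite intr_eq0_pchar0 denq_neq0.
have e : numq x * m = n * denq x.
  by apply: (@intr_inj rat); rewrite !rmorphM /= numqE mulrAC /x divfK.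
apply: (mulIf mK); apply: (mulIf dK).
by rewrite divfK // mulrAC /ratr divfK // -!intrM e.
Qed.

Lemma ratr_zmod_pchar0 : zmod_morphism (@ratr K).
Proof.
move=> x y; rewrite -[x]divq_num_den -[y]divq_num_den.
have dQ z : (denq z)%:~R != 0 :> rat by rewrite intr_eq0 denq_neq0.
have dK z : (denq z)%:~R != 0 :> K by rewrite intr_eq0_pchar0 denq_neq0.
rewrite -mulNr addf_div // -intrN -!intrM -intrD.
rewrite !ratr_frac_pchar0 ?mulf_neq0 ?denq_neq0 //.
by rewrite -mulNr addf_div // -intrN -!intrM -intrD.
Qed.

Lemma ratr_monoid_pchar0 : monoid_morphism (@ratr K).
Proof.
split=> [|x y]; first by rewrite (ratr_nat _ 1).
rewrite -[x]divq_num_den -[y]divq_num_den mulf_div -!intrM.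
by rewrite !ratr_frac_pchar0 ?mulf_neq0 ?denq_neq0 // mulf_div !intrM.
Qed.

End RatrChar0.

Lemma frac_divE (R : idomainType) (x : {fraction R}) :
  exists a b : R, b != 0 /\ x = FracField.tofrac a / FracField.tofrac b.
Proof.
elim/quotW: x => r; exists (frac r).1, (frac r).2.
have r0 := denom_ratioP r; split=> //.
apply: (canRL (mulfK _)); first by rewrite tofrac_eq0.
unlock FracField.tofrac; rewrite -[LHS]FracField.pi_mul; apply/eqmodP.
by rewrite /= /FracField.mulf FracField.equivfE !numden_Ratio ?oner_eq0 ?mulr1 // mulrC.
Qed.

(** * Valuation, units and approximation in Z_p and Q_p *)

Section PadicIntegers.
Variables (p : nat) (p_pr : prime p).
Local Notation Zp := (padic_int p_pr).
Implicit Types z w : Zp.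

Let p_gt0 : (0 < p)%N := prime_gt0 p_pr.
Let pn_gt0 n : (0 < p ^ n)%N. Proof. by rewrite expn_gt0 p_gt0. Qed.

Lemma residue_natr a n : residue (a%:R : Zp) n = (a %% p ^ n)%N.
Proof.
elim: a => [|a IHa]; first by rewrite mod0n.
by rewrite mulrS /= IHa modnDm.
Qed.

Lemma residue_leq z m n : (m <= n)%N -> (residue z n %% p ^ m)%N = residue z m.
Proof. by move=> /subnKC <-; exact: residue_modD. Qed.

Lemma residue_eq0 z n : residue z n = 0%N -> exists w, z = p%:R ^+ n * w.
Proof.
move=> zn0; have dvd m : (p ^ n %| residue z (n + m))%N.
  by rewrite /dvdn residue_modD zn0.
(* The quotient modulo [p ^ m] is read off from [z] modulo [p ^ (n + m)]. *)
have wP : `[< forall m, (residue z (n + m) %/ p ^ n)%N =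
    ((residue z (n + m.+1) %/ p ^ n) %% p ^ m)%N >].
  apply/asboolP => m; apply/eqP; rewrite -(eqn_pmul2r (pn_gt0 n)) divnK //.
  by rewrite muln_modl divnK // -expnD (addnC m) residue_leq // leq_add2l.
exists (PadicInt p_pr wP); apply: padic_intP => m.
rewrite -natrX /= residue_natr modnMml mulnC divnK //.
by rewrite residue_leq // leq_addl.
Qed.

Lemma padic_int_approx z n : exists w, z = (residue z n)%:R + p%:R ^+ n * w.
Proof.
have [|w e] := @residue_eq0 (z - (residue z n)%:R) n; last by exists w; rewrite -e subrKC.
rewrite /= residue_natr residue_mod modnDmr subnKC ?modnn // residue_le //.
Qed.

(** Inverses modulo the powers of [p] are unique, hence form a coherent sequence. *)
Lemma padic_int_unit z : residue z 1 != 0%N -> exists w, w * z = 1.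
Proof.
move=> z1; have cop n : coprime (residue z n) (p ^ n).
  case: n => [|n]; first by rewrite expn0 coprimen1.
  rewrite coprime_sym coprime_pexpl // prime_coprime //.
  by rewrite /dvdn; have := residue_leq z (ltn0Sn n); rewrite expn1 => ->.
have inv n : exists y, (residue z n * y %% p ^ n = 1 %% p ^ n)%N.
  case: (posnP (residue z n)) => [z0|zn].
    by move: (cop n); rewrite z0 /coprime gcd0n => /eqP ->; exists 0%N; rewrite !modn1.
  have /coprimeP -/(_ zn) [[u v] /= e] := cop n; exists u.
  have uv : (v * p ^ n <= u * residue z n)%N by lia.
  by rewrite mulnC -(subnK uv) e addnC modnMDl.
have /choice[y yE] := inv.
have wP : `[< forall n, y n %% p ^ n = ((y n.+1 %% p ^ n.+1) %% p ^ n) >]%N.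
  apply/asboolP => n; rewrite modn_expS.
  have e : (residue z n * y n.+1 = 1 %[mod p ^ n])%N.
    by rewrite residueE modnMml -modn_expS yE modn_expS.
  rewrite -[y n in LHS]mul1n -modnMml -e modnMml mulnAC.
  by rewrite -modnMml yE modnMml mul1n.
exists (PadicInt p_pr wP); apply: padic_intP => n.
by rewrite /= modnMml mulnC yE.
Qed.

Lemma padic_int_factor z : z != 0 -> exists n u w, z = p%:R ^+ n * u /\ w * u = 1.
Proof.
move=> z0; have ex : exists n, residue z n != 0%N.
  apply: contrapT => h; move/eqP: z0; apply; apply: padic_intP => n /=.
  by apply/eqP/negPn/negP => zn; apply: h; exists n.
(* The least index with a nonzero residue is positive because the residue modulo [p ^ 0] is 0; its
   predecessor is the valuation. *)
case: (ex_minnP ex) => -[|n] zn min.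
  by move: zn; rewrite -residue_mod expn0 modn1.
have /residue_eq0[u uE] : residue z n = 0%N.
  by apply/eqP/negPn/negP => /min; rewrite ltnn.
exists n, u; have [|w wu] := @padic_int_unit u; last by exists w.
apply: contra zn => /eqP/residue_eq0[v vE].
rewrite uE vE expr1 mulrA -exprSr -natrX /= residue_natr modnn mul0n.
by rewrite mod0n.
Qed.

Local Notation Qp := (padic p_pr).
Local Notation iota := (@padic_of_int p p_pr).

Lemma padic_of_int_inj : injective iota.
Proof. by move=> z w /eqP; rewrite /padic_of_int tofrac_eq => /eqP. Qed.

Lemma pchar_padic : [pchar Qp] =i pred0.
Proof.
apply/pcharf0P => n; rewrite -(rmorph_nat iota) -(rmorph0 iota).
rewrite (inj_eq padic_of_int_inj).
apply/eqP/eqP => [n0|->//]; have := residue_natr n n; rewrite n0 /= modn_small //.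
by apply: ltn_expl; exact: prime_gt1.
Qed.

(* A synonym, because the library's ring morphism structure on ratr, which covers
   numFieldTypes only, hides any other one. *)
Definition padic_of_rat : rat -> Qp := ratr.

HB.instance Definition _ := GRing.isZmodMorphism.Build rat Qp padic_of_rat
  (ratr_zmod_pchar0 pchar_padic).
HB.instance Definition _ := GRing.isMonoidMorphism.Build rat Qp padic_of_rat
  (ratr_monoid_pchar0 pchar_padic).

Lemma padic_p_neq0 : p%:R != 0 :> Qp.
Proof. by have /pcharf0P -> := pchar_padic; rewrite -lt0n. Qed.

(** The denominator of [x] is a power of [p] times a unit. *)
Lemma padic_mul_p (x : Qp) : exists n z, p%:R ^+ n * x = iota z.
Proof.
have [a [b [b0 ->]]] : exists a b, b != 0 /\ x = iota a / iota b := frac_divE x.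
have [n [u [w [-> wu]]]] := padic_int_factor b0; exists n, (a * w).
have pn : p%:R ^+ n != 0 :> Qp by rewrite expf_neq0 ?padic_p_neq0.
have wu' : iota w * iota u = 1 by rewrite -rmorphM wu rmorph1.
rewrite !rmorphM rmorphXn rmorph_nat.
have aux (F : fieldType) (s t v r : F) : r != 0 -> t * v = 1 -> r * (s / (r * v)) = s * t.
  move=> r0 tv; have v0 : v != 0.
    by apply: contra_eq_neq tv => ->; rewrite mulr0 eq_sym oner_eq0.
  by apply: (mulIf v0); rewrite -(mulrA s) tv mulr1; field; rewrite v0.
exact: aux.
Qed.

Local Notation pmulZ := (pmul (intr : int -> rat) p).
Local Notation inv_pZ := (inv_p (intr : int -> rat) p).
Local Notation pmulp := (pmul iota p).

(** The intersection of [Z[1/p]] with [p ^ n Z_p] is [p ^ n Z]: after clearing the denominator,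
    divisibility of an integer in [Z_p] is visible on one residue. *)
Lemma inv_p_ratr_pmul (r : rat) n : inv_pZ r -> pmulp n (padic_of_rat r) -> pmulZ n r.
Proof.
move=> [m [a]]; rewrite mul1r => ra [z rz].
have pQ : p%:R != 0 :> rat by rewrite pnatr_eq0 -lt0n.
have e : a%:~R = p%:R ^+ (m + n) * z.
  apply: padic_of_int_inj; rewrite rmorph_int rmorphM rmorphXn rmorph_nat.
  rewrite exprD -mulrA -rz -(rmorph_int padic_of_rat) -ra rmorphM rmorphXn /=.
  by rewrite rmorph_nat.
have /dvdzP[b ab] : (p%:Z ^+ (m + n) %| a)%Z.
  (* Residues are known for natural numbers, so the sign is moved to [z]. *)
  have e' : `|a|%:R = p%:R ^+ (m + n) * (if a < 0 then - z else z).
    case: a e {ra} => a /= e; first by rewrite -e.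
    by rewrite mulrN -e NegzE rmorphN opprK.
  have : residue (`|a|%:R : Zp) (m + n) = 0%N.
    by rewrite e' -natrX /= residue_natr modnn mul0n mod0n.
  by rewrite residue_natr dvdzE abszX /dvdn => ->.
exists b; apply: (mulfI (expf_neq0 m pQ)); rewrite ra ab mulrA -exprD mulrC.
by rewrite rmorphM rmorphXn.
Qed.

(** Some [p ^ m x] is in [Z_p]; it is replaced by its residue modulo [p ^ (m + n)]. *)
Lemma inv_p_dense (x : Qp) n : exists2 r : rat, inv_pZ r & pmulp n (padic_of_rat r - x).
Proof.
have [m [z e]] := padic_mul_p x.
have [w] := padic_int_approx z (m + n); set c := residue _ _ => we.
have pQ : p%:R != 0 :> rat by rewrite pnatr_eq0 -lt0n.
exists (c%:R / p%:R ^+ m).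
  exists m; exists c%:Z.
  by rewrite mulrCA divff ?mulr1 ?expf_neq0 // mul1r.
exists (- w); apply: (mulfI (expf_neq0 m padic_p_neq0)).
rewrite mulrBr e we rmorphD opprD rmorph_nat rmorphM rmorphXn rmorph_nat.
have -> : p%:R ^+ m * padic_of_rat (c%:R / p%:R ^+ m) = c%:R.
  rewrite -(rmorph_nat padic_of_rat p) -rmorphXn -rmorphM.
  by rewrite mulrCA divff ?mulr1 ?rmorph_nat ?expf_neq0.
by rewrite addrA subrr add0r rmorphN mulrN mulrN mulrA -exprD.
Qed.

End PadicIntegers.

(** * Subgroups of p-power index *)

(* The p'-core acts with orbits whose sizes are prime to p, and these sizes divide
   the size of the set, which is a power of p. *)
Lemma nilpotent_transitive_pgroup (T : finType) (P : {group {perm T}}) p a :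
  prime p -> #|T| = (p ^ a)%N -> nilpotent P -> [transitive P, on [set: T]%SET | 'P]%g ->
  (p.-group P)%g.
Proof.
move=> p_pr cardT nilP trP; pose Q := ('O_p^'(P))%G.
have QP : Q \subset P := pcore_sub _ _.
suff Q1 : Q :=: 1%g.
  by have := nilpotent_pcoreC p nilP; rewrite -/Q Q1 dprodg1 => <-; exact: pcore_pgroup.
apply/trivgP/fintype.subsetP => s sQ; apply/set1P/permP => x; rewrite perm1.
pose S := ('C_P[x | 'P])%G.
have SP : S \subset P by exact: subsetIl.
have indS : #|P : S|%g = (p ^ a)%N.
  by rewrite -card_orbit (atransP trP) ?inE // cardsT.
have QS : #|Q : S|%g = 1%N.
  apply/eqP; rewrite -dvdn1.
  have /eqP <- : coprime (p ^ a) #|Q|.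
    by rewrite coprimeXl // (pnat_coprime (pnat_id p_pr)) //; exact: pcore_pgroup.
  rewrite dvdn_gcd -indexgI dvdn_indexg andbT indexgI -indS.
  (* As [S] normalises [Q], the index of their intersection in [Q] is that of [S] in [Q S], which
     divides the index of [S] in [P]. *)
  have nQS : (S \subset 'N(Q))%g by exact: fintype.subset_trans SP (gFnorm _ P).
  rewrite -indexMg -norm_joinEl // -(@Lagrange_index _ P (S <*> Q)%G S).
  - by rewrite dvdn_mull.
  - by rewrite join_subG SP QP.
  - exact: joing_subl.
have : s \in S.
  apply: (fintype.subsetP _ s sQ); rewrite -indexg_eq1 QS //.
by move=> /setIP[_ /astab1P].
Qed.

Lemma invmx_mulV (A : comUnitRingType) d (M N : 'M[A]_d) :
  M \in unitmx -> N \in unitmx -> invmx (invmx M *m N) = invmx N *m M.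
Proof.
move=> uM uN; have uMN : invmx M *m N \in unitmx by rewrite unitmx_mul unitmx_inv uM.
rewrite -[RHS]mulmx1 -(mulmxV uMN) mulmxA -(mulmxA _ M) mulKVmx //.
by rewrite mulVmx // mul1mx.
Qed.

Lemma conjmx_sub1 (A : comUnitRingType) d (M N : 'M[A]_d) : M \in unitmx ->
  M *m N *m invmx M - 1%:M = M *m (N - 1%:M) *m invmx M.
Proof. by move=> uM; rewrite mulmxBr mulmx1 mulmxBl mulmxV. Qed.

Lemma invmxM_conj (A : comUnitRingType) d (X Y M N : 'M[A]_d) :
  X \in unitmx -> Y \in unitmx -> N \in unitmx ->
  invmx (X *m Y) *m (M *m N) = (invmx Y *m N) *m
    (invmx N *m (invmx X *m M) *m invmx (invmx N)).
Proof.
move=> uX uY uN; have -> : invmx (X *m Y) = invmx Y *m invmx X.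
  by rewrite -{1}(invmxK X) invmx_mulV ?unitmx_inv.
by rewrite invmxK -!mulmxA mulKVmx.
Qed.

Lemma invmx_conj (A : comUnitRingType) d (X M : 'M[A]_d) :
  X \in unitmx -> M \in unitmx ->
  X *m invmx M = X *m invmx (invmx X *m M) *m invmx X.
Proof. by move=> uX uM; rewrite invmx_mulV // -!mulmxA mulmxV // mulmx1. Qed.

Section Unitriangular.
Variables (A : comUnitRingType) (d : nat).
Implicit Types M N : 'M[A]_d.

Lemma unitriangular_unit M : unitriangular M -> M \in unitmx.
Proof. by move=> [Mt M1]; rewrite unitmxE det_trig // big1 ?unitr1. Qed.

(** The groups [1 + band k], for positive [k], form a central series of the unitriangular group. *)
Definition band k M : Prop := forall i j : 'I_d, (i < j + k)%N -> M i j = 0.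

Lemma band_mul k l M N : band k M -> band l N -> band (k + l) (M *m N).
Proof.
move=> hM hN i j ij; rewrite mxE big1 // => c _.
have [ick|cki] := ltnP i (c + k); first by rewrite hM ?mul0r.
by rewrite hN ?mulr0 //; lia.
Qed.

Lemma band_sub k M N : band k M -> band k N -> band k (M - N).
Proof. by move=> hM hN i j ij; rewrite !mxE hM ?hN ?subr0. Qed.

Lemma unitriangular_band M : unitriangular M <-> band 1 (M - 1%:M).
Proof.
split=> [[/is_trig_mxP Mt M1] i j|h].
  rewrite addn1 ltnS leq_eqVlt => /predU1P[/val_inj ->|ij].
    by rewrite !mxE M1 eqxx subrr.
  by rewrite !mxE Mt // -val_eqE ltn_eqF ?subr0.
split=> [|i]; last first.
  by have := h i i; rewrite !mxE eqxx addn1 ltnSn => /(_ isT)/eqP; rewrite subr_eq0 => /eqP.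
apply/is_trig_mxP => i j ij; have := h i j; rewrite !mxE -val_eqE ltn_eqF //= subr0.
by apply; lia.
Qed.

Lemma band0 M : unitriangular M -> band 0 M.
Proof. by move=> [/is_trig_mxP Mt _] i j; rewrite addn0; exact: Mt. Qed.

(** With [m = M - 1] and [n = N - 1], the commutator minus 1 is [(m n - n m) M^-1 N^-1], and both
    products lie one subdiagonal lower than [n]. *)
Lemma commutator_band k M N : unitriangular M -> unitriangular N ->
    unitriangular (invmx M) -> unitriangular (invmx N) ->
  band k (N - 1%:M) -> band k.+1 (M *m N *m invmx M *m invmx N - 1%:M).
Proof.
move=> uM uN uM' uN' bN.
have -> : M *m N *m invmx M *m invmx N - 1%:M =
    ((M - 1%:M) *m (N - 1%:M) - (N - 1%:M) *m (M - 1%:M)) *m (invmx M *m invmx N).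
  have -> : (M - 1%:M) *m (N - 1%:M) - (N - 1%:M) *m (M - 1%:M) = M *m N - N *m M.
    rewrite !mulmxBl !mulmxBr !mul1mx !mulmx1; move: (M *m N) (N *m M) => MN NM.
    by apply/matrixP => i j; rewrite !mxE; ring.
  rewrite mulmxBl !mulmxA -[N *m M *m _]mulmxA mulmxV ?unitriangular_unit //.
  by rewrite mulmx1 mulmxV ?unitriangular_unit.
have -> : k.+1 = (k.+1 + (0 + 0))%N by rewrite !addn0.
have bM : band 1 (M - 1%:M) by exact/unitriangular_band.
apply: band_mul; last by apply: band_mul; exact: band0.
by apply: band_sub; [rewrite -add1n|rewrite -addn1]; exact: band_mul.
Qed.

End Unitriangular.

(** * Cosets and the permutations induced on them *)

Section CosetRepresentatives.
Variables (A : comUnitRingType) (d : nat).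
Implicit Types (M N : 'M[A]_d) (D E : set 'M[A]_d).

(** The ambient group is the whole unitriangular group, so that lattices, congruence subgroups and
    intersections are treated alike. *)
Definition mx_group D : Prop :=
  [/\ D `<=` [set M | unitriangular M], D 1%:M,
      (forall M N, D M -> D N -> D (M *m N)) & (forall M, D M -> D (invmx M))].

Lemma mx_group_unit D M : mx_group D -> D M -> M \in unitmx.
Proof. by move=> [uD _ _ _] /uD; exact: unitriangular_unit. Qed.

Lemma mx_groupI D E : mx_group D -> mx_group E -> mx_group (D `&` E).
Proof.
move=> [uD D1 DM DV] [uE E1 EM EV]; split=> //.
- by move=> M [/uD].
- by move=> M N [? ?] [? ?]; split; [exact: DM|exact: EM].
- by move=> M [? ?]; split; [exact: DV|exact: EV].
Qed.

Definition coset_reps D E n (s : 'I_n -> 'M[A]_d) : Prop :=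
  [/\ forall i, D (s i), forall M, D M -> exists i, E (invmx (s i) *m M) &
      forall i j, E (invmx (s i) *m s j) -> i = j].

(** The cosets of [M] and [M'] agree exactly when [M^-1 M'] is in [E]; representatives replace the
    cardinality of a set of sets. *)
Lemma index_eqP D E n : mx_group D -> mx_group E -> E `<=` D ->
  index_eq D E n <-> exists s : 'I_n -> 'M[A]_d, coset_reps D E s.
Proof.
move=> gD gE ED; have [_ E1 EM EV] := gE.
pose coset M := [set M *m N | N in E].
have coset_eq M M' : M \in unitmx -> M' \in unitmx ->
    coset M = coset M' <-> E (invmx M *m M').
  move=> uM uM'; split=> [e|h].
    have : coset M' M' by exists 1%:M; rewrite ?mulmx1.
    by rewrite -e => -[N EN <-]; rewrite mulKmx.
  rewrite predeqE => X; split=> -[N EN <-].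
    exists (invmx (invmx M *m M') *m N); first by apply: (EM) => //; exact: EV.
    rewrite mulmxA; congr (_ *m _).
    rewrite -[LHS](mulKVmx uM) [invmx M *m (_ *m _)]mulmxA mulmxV ?mulmx1 //.
    by rewrite unitmx_mul unitmx_inv uM.
  exists (invmx M *m M' *m N); first exact: EM.
  by rewrite -!mulmxA mulKVmx.
have uD M : D M -> M \in unitmx by exact: mx_group_unit.
rewrite /index_eq card_eq_sym; split.
  move=> /card_set_bijP[F [Ffun Finj Fsurj]].
  have /choice[s sE] : forall i : 'I_n, exists M, D M /\ coset M = F i.
    by move=> i; have [M DM e] := Ffun i (ltn_ord i); exists M.
  exists s; split=> [i|M DM|i j]; first by have [] := sE i.
    have [|i /= ilt e] := Fsurj (coset M); first by exists M.
    by exists (Ordinal ilt); have [Ds se] := sE (Ordinal ilt); apply/coset_eq; rewrite ?uD ?se.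
  have [Di ei] := sE i; have [Dj ej] := sE j.
  move=> /coset_eq; rewrite ei ej => h; apply/val_inj/Finj; rewrite ?inE //=.
  by apply: h; exact: uD.
move=> [s [Ds scov sinj]]; apply/card_set_bijP.
exists (fun i => if insub i is Some j then coset (s j) else set0); split.
- by move=> i /= ilt; rewrite insubT; exists (s (Ordinal ilt)).
- move=> i j; rewrite !inE /= => ilt jlt; rewrite !insubT.
  by move=> /coset_eq -/(_ (uD _ (Ds _)) (uD _ (Ds _)))/sinj/(congr1 val).
- move=> _ [M DM <-]; have [i Ei] := scov M DM; exists (val i) => //=.
  by rewrite valK; apply/coset_eq => //; exact: uD.
Qed.

(* D permutes the cosets of E through a finite nilpotent group, which is a p-group
   because the number of cosets is a power of p. *)
Lemma index_ppower D E p a : prime p -> mx_group D -> mx_group E -> E `<=` D ->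
  index_eq D E (p ^ a) -> exists m, forall M, D M -> E (M ^+ (p ^ m)).
Proof.
move=> p_pr gD gE ED /index_eqP-/(_ gD gE ED)[s [Ds scov sinj]].
have [uD D1 DM DV] := gD; have [_ E1 EM EV] := gE.
have un M : D M -> M \in unitmx by exact: mx_group_unit.
have [i0 _] := scov _ D1.
(* [rep M] is the index of the coset of [M]; outside [D] its value is arbitrary, and [i0] only
   ensures that there is one. *)
have /choice[rep repP] : forall M, exists i, D M -> E (invmx (s i) *m M).
  by move=> M; have [/scov[i Ei]|nD] := pselect (D M); [exists i|exists i0].
have rep_eq M i : D M -> E (invmx (s i) *m M) -> rep M = i.
  move=> hM Ei; apply: sinj.
  have -> : invmx (s (rep M)) *m s i =
      invmx (s (rep M)) *m M *m invmx (invmx (s i) *m M).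
    rewrite -mulmxA; congr (_ *m _).
    have usM : invmx (s i) *m M \in unitmx by rewrite unitmx_mul unitmx_inv !un.
    by rewrite -[LHS]mulmx1 -(mulmxV usM) !mulmxA mulmxV ?un // mul1mx.
  by apply: (EM); [exact: repP|exact: EV].
pose act g i := rep (g *m s i).
have actM g h i : D g -> D h -> act (g *m h) i = act g (act h i).
  move=> Dg Dh; apply: rep_eq; first by apply: (DM) => //; exact: DM.
  have -> : invmx (s (act g (act h i))) *m (g *m h *m s i) =
      invmx (s (act g (act h i))) *m (g *m s (act h i)) *m
      (invmx (s (act h i)) *m (h *m s i)).
    by rewrite -!mulmxA mulKVmx ?un.
  by apply: (EM); apply: repP; exact: DM.
have act1 i : act 1%:M i = i by apply: rep_eq; rewrite ?mul1mx ?mulVmx ?un.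
have act_inj g : D g -> injective (act g).
  move=> Dg; apply: (can_inj (g := act (invmx g))) => i.
  by rewrite -actM ?mulVmx ?un //; exact: DV.
(* The permutations induced by the elements of [D] in [1 + band k]. For [k = 1] they form the whole
   image of [D], and these groups bound its lower central series. *)
pose img k : {set {perm 'I_(p ^ a)}} := [set x : {perm 'I_(p ^ a)} | `[< exists g,
  [/\ D g, band k (g - 1%:M) & forall i, x i = act g i] >]]%SET.
have imgP k (x : {perm 'I_(p ^ a)}) : reflect
    (exists g, [/\ D g, band k (g - 1%:M) & forall i, x i = act g i])
    (x \in img k) by rewrite inE; exact: asboolP.
have img_group k : group_set (img k).
  apply/group_setP; split.
    apply/imgP; exists 1%:M; split=> // [i j _|i]; first by rewrite subrr mxE.
    by rewrite perm1 act1.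
  move=> x y /imgP[g [Dg bg gE']] /imgP[h [Dh bh hE]]; apply/imgP.
  (* Permutations compose from left to right, whence the order of [h] and [g]. *)
  exists (h *m g); split=> [||i]; first exact: DM; last first.
    by rewrite permM gE' hE actM.
  have -> : h *m g - 1%:M = (h - 1%:M) *m g + (g - 1%:M).
    by rewrite mulmxBl mul1mx addrA subrK.
  move=> i j ij; rewrite mxE bg // addr0.
  by apply: (band_mul bh (band0 (uD _ Dg))); rewrite addn0.
pose P := Group (img_group 1%N).
have LP k : 'L_k.+1(P)%g \subset img k.+1.
  elim: k => [|k IHk]; first by rewrite lcn1.
  rewrite lcnSn (_ : img k.+2 = Group (img_group k.+2)) // gen_subG.
  apply/fintype.subsetP => _ /imset2P[x y xL /imgP[t [Dt _ tE]] ->].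
  have /imgP[g [Dg bg gE']] := fintype.subsetP IHk _ xL.
  have invE (z : {perm 'I_(p ^ a)}) h : D h -> (forall i, z i = act h i) ->
      forall i, (z^-1)%g i = act (invmx h) i.
    move=> Dh zE i; apply: (perm_inj (s := z)); rewrite permKV zE -actM //; last exact: DV.
    by rewrite mulmxV ?un.
  apply/imgP; exists (t *m g *m invmx t *m invmx g).
  have Dtg : D (t *m g) by exact: DM.
  have Dtgt : D (t *m g *m invmx t) by apply: (DM) => //; exact: DV.
  split=> [||i]; first by apply: (DM) => //; exact: DV.
    by apply: commutator_band => //; apply: (uD) => //; exact: DV.
  rewrite commgEl conjgE !permM (invE _ _ Dg gE') (invE _ _ Dt tE) gE' tE.
  by rewrite !actM //; exact: DV.
have nilP : nilpotent P.
  apply/lcnP; exists d; apply/trivgP; apply: fintype.subset_trans (LP d) _.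
  apply/fintype.subsetP => x /imgP[g [Dg bg gE']]; apply/set1P/permP => i.
  have /eqP : g - 1%:M = 0.
    by apply/matrixP => j l; rewrite bg ?mxE //; have := ltn_ord j; lia.
  by rewrite subr_eq0 gE' => /eqP ->; rewrite act1 perm1.
have inP g (Dg : D g) : perm (act_inj g Dg) \in P.
  apply/imgP; exists g; split=> // [|i]; last by rewrite permE.
  exact/unitriangular_band/uD.
have trP : [transitive P, on [set: 'I_(p ^ a)]%SET | 'P]%g.
  apply/imsetP; exists i0; rewrite ?inE //; apply/finset.setP => j; rewrite inE; symmetry.
  (* This element carries the coset [i0] to the coset [j]. *)
  have Dg : D (s j *m invmx (s i0)) by apply: (DM) => //; exact: DV.
  apply/orbitP; exists (perm (act_inj _ Dg)) => //=.
  by rewrite /aperm permE; apply: rep_eq; rewrite mulmxKV ?mulVmx ?un.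
have pP := nilpotent_transitive_pgroup p_pr (card_ord _) nilP trP.
have [m cardP] := p_natP pP; exists m => M hM.
have DX k : D (M ^+ k) by elim: k => [|k IHk]; rewrite ?expr0 // exprS; exact: DM.
have actX k i : (perm (act_inj M hM) ^+ k)%g i = act (M ^+ k) i.
  elim: k => [|k IHk]; first by rewrite expg0 expr0 perm1 act1.
  by rewrite expgSr permM IHk permE exprS actM.
(* [M ^+ (p ^ m)] acts trivially. It fixes in particular the coset of 1, whose representative lies
   in [E], so it lies in [E] too. *)
have := actX (p ^ m)%N (rep 1%:M).
rewrite -cardP expg_cardG // perm1 cardP /act => e.
have Er : E (s (rep 1%:M)).
  by rewrite -[s _]invmxK; apply: (EV); rewrite -[invmx _]mulmx1; exact: repP.
have := repP (M ^+ (p ^ m) *m s (rep 1%:M)) (DM _ _ (DX _) (Ds _)); rewrite -e.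
move=> /(EM _ _ Er); rewrite mulKVmx ?un // => /EM/(_ (EV _ Er)).
by rewrite mulmxK ?un.
Qed.

End CosetRepresentatives.

(** The induced map on cosets is injective because [E] is the preimage of [E'] in [D], and
    surjective because the image of [D] meets every coset of [E'] in [D']. *)
Lemma index_transfer (K L : fieldType) d (f : {rmorphism K -> L})
    (D E : set 'M[K]_d) (D' E' : set 'M[L]_d) n :
  mx_group D -> mx_group E -> E `<=` D -> mx_group D' -> mx_group E' -> E' `<=` D' ->
  (forall M, D M -> D' (map_mx f M)) ->
  (forall M, D M -> E M <-> E' (map_mx f M)) ->
  (forall M', D' M' -> exists2 M, D M & E' (invmx (map_mx f M) *m M')) ->
  index_eq D E n <-> index_eq D' E' n.
Proof.
move=> gD gE ED gD' gE' ED' DD' EE' dense.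
rewrite !index_eqP //.
have [_ _ DM DV] := gD; have [_ _ EM' EV'] := gE'.
have un M : D' M -> M \in unitmx by exact: mx_group_unit.
have DVM M N : D M -> D N -> D (invmx M *m N) by move=> *; apply: (DM) => //; exact: DV.
have EVM M N P : D' M -> D' N -> D' P -> E' (invmx M *m N) -> E' (invmx N *m P) ->
    E' (invmx M *m P).
  by move=> ? uN ? h /(EM' _ _ h); rewrite -mulmxA mulKVmx ?un.
have ESym M N : D' M -> D' N -> E' (invmx M *m N) -> E' (invmx N *m M).
  by move=> uM uN /EV'; rewrite invmx_mulV ?un.
have mapVM M N : map_mx f (invmx M *m N) = invmx (map_mx f M) *m map_mx f N.
  by rewrite map_mxM map_invmx.
split=> -[s [Ds scov sinj]].
  exists (fun i => map_mx f (s i)); split=> [i|M' DM'|i j]; first exact: DD'.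
    have [M hM EM] := dense _ DM'; have [i Ei] := scov _ hM; exists i.
    apply: (EVM _ (map_mx f M)) => //; [exact: DD'|exact: DD'|].
    by rewrite -mapVM -EE' //; exact: DVM.
  by rewrite -mapVM -EE' => [|]; [exact: sinj|exact: DVM].
have /choice[t tP] : forall i, exists M, D M /\ E' (invmx (map_mx f M) *m s i).
  by move=> i; have [M ? ?] := dense _ (Ds i); exists M.
have Dt i : D (t i) by have [] := tP i.
have D't i : D' (map_mx f (t i)) by exact: DD'.
have E't i : E' (invmx (map_mx f (t i)) *m s i) by have [] := tP i.
exists t; split=> [//|M hM|i j].
  have [i Ei] := scov _ (DD' _ hM); exists i.
  by rewrite EE' ?mapVM; [apply: EVM Ei => //; exact: DD'|exact: DVM].
rewrite EE' ?mapVM; last exact: DVM.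
move=> tij; apply: sinj; apply: (EVM _ (map_mx f (t i))) => //; first exact: ESym.
exact: EVM tij _.
Qed.

(** The geometric series of the nilpotent matrix [1 - M]. It shows that inverses stay integral. *)
Lemma invmx_unitriangular (K : fieldType) d (M : 'M[K]_d) : unitriangular M ->
  invmx M = \sum_(i < d) (1%:M - M) ^+ i.
Proof.
move=> uM; pose N : 'M[K]_d := 1%:M - M.
have Nd : N ^+ d = 0.
  apply: strictly_lower_nilpotent => // i j ij.
  have /unitriangular_band/(_ i j) := uM; rewrite addn1 ltnS => /(_ ij).
  by rewrite !mxE => /eqP; rewrite subr_eq0 => /eqP ->; rewrite subrr.
have e : M *m (\sum_(i < d) N ^+ i) = 1%:M.
  have := subrX1 N d; rewrite Nd sub0r => /(congr1 -%R); rewrite opprK -mulNr => e1.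
  by rewrite [RHS]e1 -mulmxE; congr (_ *m _); rewrite opprB; symmetry; exact: subKr.
by rewrite -[RHS](mulKmx (unitriangular_unit uM)) e mulmx1.
Qed.

(** * Integral points and congruence subgroups *)

Section IntegralPoints.
Variables (d : nat) (G : unipotent_Zgroup d).

Lemma points_group (K : fieldType) : mx_group (points G K).
Proof.
split=> [M []//|||M GM]; [exact: points_one|exact: points_mul|].
apply: (points_inv GM); rewrite mulmxV // unitriangular_unit //.
by have [] := GM.
Qed.

Lemma subgroup_mx_group (K : fieldType) (H : set 'M[K]_d) :
  subgroup (points G K) H <-> H `<=` points G K /\ mx_group H.
Proof.
split=> [[HG H1 HM HV]|[HG [_ H1 HM HV]]]; split=> //; split=> //.
by move=> M /HG[].
Qed.

Section LocalRing.
Variables (O : comNzRingType) (K : fieldType) (f : {rmorphism O -> K}) (p : nat).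
Hypothesis f_inj : injective f.
Hypothesis K0 : [pchar K] =i pred0.
Hypothesis p_pr : prime p.

Let p0 : p%:R != 0 :> K.
Proof. by move/pcharf0P: K0 => ->; rewrite -lt0n prime_gt0. Qed.

Definition integral_points : set 'M[K]_d := map_mx f @` points G O.

(** The principal congruence subgroup of level [p ^ n]; level 0 gives all integral points. *)
Definition congruence_points n : set 'M[K]_d :=
  [set M | points G K M /\ pmul_mx f p n (M - 1%:M)].

(** As [f] is injective, the equations of [G] hold over [O] once they hold over [K]. *)
Lemma integral_pointsE M :
  integral_points M <-> points G K M /\ pmul_mx f p 0 M.
Proof.
split=> [[N GN <-]|[GM fM]].
  by split=> [|i j]; [exact: points_map|rewrite mxE; exact: pmul0_f].
have fE i j : exists x, f x = M i j.
  by have [x e] := fM i j; exists x; rewrite e mul1r.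
have e : map_mx f (\matrix_(i, j) sval (cid (fE i j))) = M.
  by apply/matrixP => i j; rewrite !mxE; case: cid.
by exists (\matrix_(i, j) sval (cid (fE i j))) => //; apply: (points_map_inj f_inj); rewrite e.
Qed.

Lemma congruence_points0 : congruence_points 0 = integral_points.
Proof.
rewrite predeqE => M; rewrite integral_pointsE; split=> -[GM fM]; split=> //.
  by rewrite -[M](subrK 1%:M); apply: pmul_mxD => //; exact: pmul_mx1.
by apply: pmul_mxB => //; exact: pmul_mx1.
Qed.

Lemma congruence_points_le m n : (m <= n)%N -> congruence_points n `<=` congruence_points m.
Proof. by move=> mn M [GM fM]; split=> //; exact: pmul_mx_le fM. Qed.

Lemma mulmx_pmul0 n (M N : 'M[K]_d) :
  pmul_mx f p 0 M -> pmul_mx f p n N -> pmul_mx f p n (M *m N).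
Proof. by move=> hM hN; rewrite -[n]add0n; exact: pmul_mxM. Qed.

Lemma pmul0_exp (N : 'M[K]_d) k : pmul_mx f p 0 N -> pmul_mx f p 0 (N ^+ k).
Proof.
move=> hN; elim: k => [|k IHk]; first by rewrite expr0; exact: pmul_mx1.
by rewrite exprS; exact: mulmx_pmul0.
Qed.

Lemma invmx_pmul0 (M : 'M[K]_d) : unitriangular M -> pmul_mx f p 0 M ->
  pmul_mx f p 0 (invmx M).
Proof.
move=> uM hM i j; rewrite invmx_unitriangular // summxE.
apply: pmul_sum => k _; apply: pmul0_exp.
by apply: pmul_mxB => //; exact: pmul_mx1.
Qed.

Lemma congruence_points_group n : mx_group (congruence_points n).
Proof.
have GK := points_group K; have [_ G1 GM GV] := GK.
have int M : congruence_points n M -> pmul_mx f p 0 M.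
  by move=> /(congruence_points_le (leq0n n)); rewrite congruence_points0 => /integral_pointsE[].
split.
- by move=> M [[]].
- by split=> // i j; rewrite subrr mxE; exact: pmul_0.
- move=> M N hM hN; have [gM cM] := hM; have [gN cN] := hN; split; first exact: GM.
  have -> : M *m N - 1%:M = M *m (N - 1%:M) + (M - 1%:M).
    by rewrite mulmxBr mulmx1 addrA subrK.
  by apply: pmul_mxD => //; apply: mulmx_pmul0 => //; exact: int.
- move=> M hM; have [gM cM] := hM; split; first exact: GV.
  have uM : M \in unitmx by exact: mx_group_unit GK gM.
  have -> : invmx M - 1%:M = invmx M *m - (M - 1%:M).
    by rewrite opprB mulmxBr mulmx1 mulVmx.
  apply: mulmx_pmul0; last by rewrite -(sub0r (M - _)); apply: pmul_mxB => // i j;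
    rewrite mxE; exact: pmul_0.
  by apply: invmx_pmul0; [have [] := gM|exact: int].
Qed.

Lemma integral_points_group : mx_group integral_points.
Proof. by rewrite -congruence_points0; exact: congruence_points_group. Qed.

(* Elements close to 1 have an integral p^m-th root. *)
Lemma index_ppower_open (E : set 'M[K]_d) a : mx_group E ->
  E `<=` integral_points -> index_eq integral_points E (p ^ a) ->
  exists n, congruence_points n `<=` E.
Proof.
move=> gE EG /(index_ppower p_pr integral_points_group gE EG)[m mE].
(* At this level [root_pmul] makes the [p ^ m]-th root integral. *)
exists (d * m)%N => M [GM cM].
have pm0 : (0 < p ^ m)%N by rewrite expn_gt0 prime_gt0.
have [r Gr rM] := points_root K0 pm0 GM; rewrite -rM; apply: mE.
rewrite -congruence_points0; split=> //.
apply: (root_pmul p0 (m := m) (n := 0)); first exact: points_strictly_lower Gr.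
by rewrite rM.
Qed.

End LocalRing.
End IntegralPoints.

(** * Strong approximation *)

Section PadicApproximation.
Variables (p : nat) (p_pr : prime p).
Local Notation Qp := (padic p_pr).
Local Notation iota := (@padic_of_int p p_pr).
Local Notation phi := (@padic_of_rat p p_pr).

Let p0 : p%:R != 0 :> Qp := padic_p_neq0 p_pr.

(** If [p ^ e] clears the denominators of [M], multiplication by [M] loses at most [e] digits. *)
Lemma mulmx_bounded m n l (M : 'M[Qp]_(m, n)) : exists e,
  (forall k (N : 'M_(n, l)), pmul_mx iota p (k + e) N -> pmul_mx iota p k (M *m N)) /\
  (forall k (N : 'M_(l, m)), pmul_mx iota p (k + e) N -> pmul_mx iota p k (N *m M)).
Proof.
have [e eE] : exists e, forall i j, exists z, p%:R ^+ e * M i j = iota z.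
  have /choice[e eE] : forall ij : 'I_m * 'I_n, exists e,
      exists z, p%:R ^+ e * M ij.1 ij.2 = iota z.
    by move=> ij; exact: padic_mul_p.
  exists (\max_ij e ij) => i j; have [z /= zE] := eE (i, j).
  have le : (e (i, j) <= \max_ij e ij)%N by exact: leq_bigmax.
  exists (p%:R ^+ (\max_ij e ij - e (i, j)) * z).
  by rewrite rmorphM rmorphXn rmorph_nat /= -zE mulrA -exprD subnK.
have bound k x i j : pmul iota p (k + e) x -> pmul iota p k (M i j * x).
  move=> hx; apply/(pmul_pM _ p0 e); rewrite mulrA addnC; have [z ->] := eE i j.
  by rewrite -[(k + e)%N]add0n; apply: pmul_M => //; exact: pmul0_f.
exists e; split=> k N hN i j; rewrite mxE; apply: pmul_sum => c _; first exact: bound.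
by rewrite mulrC; exact: bound.
Qed.

Definition mx_continuous m n k l (F : 'M[Qp]_(m, n) -> 'M[Qp]_(k, l)) (X : 'M[Qp]_(m, n)) :=
  forall a, exists b, forall Y,
    pmul_mx iota p b (Y - X) -> pmul_mx iota p a (F Y - F X).

Lemma eq_mx_continuous m n k l (F F' : 'M[Qp]_(m, n) -> 'M[Qp]_(k, l)) X :
  F =1 F' -> mx_continuous F X -> mx_continuous F' X.
Proof. by move=> /funext ->. Qed.

Lemma mx_continuous_id m n (X : 'M[Qp]_(m, n)) : mx_continuous id X.
Proof. by move=> a; exists a. Qed.

Lemma mx_continuous_cst m n k l (C : 'M[Qp]_(k, l)) (X : 'M[Qp]_(m, n)) :
  mx_continuous (fun=> C) X.
Proof. by move=> a; exists 0%N => Y _ i j; rewrite subrr mxE; exact: pmul_0. Qed.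

Lemma mx_continuousD m n k l (F F' : 'M[Qp]_(m, n) -> 'M[Qp]_(k, l)) X :
  mx_continuous F X -> mx_continuous F' X -> mx_continuous (fun Y => F Y + F' Y) X.
Proof.
move=> cF cF' a; have [b hb] := cF a; have [b' hb'] := cF' a.
exists (maxn b b') => Y hY; rewrite opprD addrACA; apply: pmul_mxD.
  by apply: hb; exact: pmul_mx_le (leq_maxl _ _) hY.
by apply: hb'; exact: pmul_mx_le (leq_maxr _ _) hY.
Qed.

Lemma mx_continuousM m n k l r (F : 'M[Qp]_(m, n) -> 'M[Qp]_(k, l))
    (F' : 'M[Qp]_(m, n) -> 'M[Qp]_(l, r)) X :
  mx_continuous F X -> mx_continuous F' X -> mx_continuous (fun Y => F Y *m F' Y) X.
Proof.
move=> cF cF' a; have [e [he _]] := mulmx_bounded r (F X).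
have [e' [_ he']] := mulmx_bounded k (F' X).
have [b hb] := cF (a + e')%N; have [b' hb'] := cF' (a + e)%N.
exists (maxn b b') => Y hY.
have {}hb := hb _ (pmul_mx_le (leq_maxl _ _) hY).
have {}hb' := hb' _ (pmul_mx_le (leq_maxr _ _) hY).
have -> : F Y *m F' Y - F X *m F' X =
    (F Y - F X) *m (F' Y - F' X) + F X *m (F' Y - F' X) + (F Y - F X) *m F' X.
  by rewrite -mulmxDl subrK mulmxBr mulmxBl addrA subrK.
apply: pmul_mxD; last exact: he'.
apply: pmul_mxD; last exact: he.
by apply: (pmul_mx_le _ (pmul_mxM hb hb')); lia.
Qed.

Lemma mx_continuous_expm d (X : 'M[Qp]_d) : mx_continuous (@expm Qp d) X.
Proof.
have cX k : mx_continuous (fun Y : 'M[Qp]_d => Y ^+ k) X.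
  elim: k => [|k IHk]; first exact: mx_continuous_cst.
  apply: eq_mx_continuous (mx_continuousM (mx_continuous_id X) IHk) => Y.
  by rewrite exprS.
pose F i (Y : 'M[Qp]_d) := i`!%:R^-1 *: Y ^+ i.
have cF i : mx_continuous (F i) X.
  apply: eq_mx_continuous (mx_continuousM (mx_continuous_cst (i`!%:R^-1)%:M X) (cX i)) => Y.
  exact: mul_scalar_mx.
suff cS (r : seq 'I_d) : mx_continuous (fun Y => \sum_(i <- r) F i Y) X by exact: cS.
elim: r => [|i r IHr].
  by apply: eq_mx_continuous (mx_continuous_cst 0 X) => Y; rewrite big_nil.
by apply: eq_mx_continuous (mx_continuousD (cF i) IHr) => Y; rewrite big_cons.
Qed.

(** The product uniformity involves finitely many entries, so the largest of their precisions serves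
    for all. *)
Lemma nbhs_mxP d (X : 'M[Qp]_d) (U : set 'M[Qp]_d) :
  nbhs X U <-> exists n, forall Y, pmul_mx iota p n (Y - X) -> U Y.
Proof.
rewrite mx_ent_nbhsE; split.
  move=> [V [P entP PV] VU].
  have /choice[n nP] : forall ij : 'I_d * 'I_d, exists n, padic_close n `<=` P ij.1 ij.2.
    by move=> ij; have [n _ h] := entP ij.1 ij.2; exists n.
  exists (\max_ij n ij) => Y hY; apply: VU; apply/xsectionP; apply: PV => /= i j.
  apply: (nP (i, j)) => /=; have := hY i j; rewrite !mxE.
  by apply: pmul_le; exact: leq_bigmax.
move=> [n h]; exists [set MN | pmul_mx iota p n (MN.2 - MN.1)].
  exists (fun _ _ => padic_close n) => [i j|MN /= hMN i j]; first by exists n.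
  by rewrite !mxE; exact: hMN.
by move=> Y /xsectionP/h.
Qed.

Lemma closure_mxP d (X : 'M[Qp]_d) (S : set 'M[Qp]_d) :
  closure S X <-> forall n, exists2 Y, S Y & pmul_mx iota p n (Y - X).
Proof.
split=> [clX n|h U /nbhs_mxP[n nU]]; last first.
  by have [Y SY cY] := h n; exists Y; split=> //; exact: nU.
have [|Y [SY cY]] := clX [set Y | pmul_mx iota p n (Y - X)]; last by exists Y.
by apply/nbhs_mxP; exists n.
Qed.

Section Group.
Variables (d : nat) (G : unipotent_Zgroup d).

Local Notation Kn := (congruence_points G iota p).

Lemma invmx_close (X Y : 'M[Qp]_d) : X \in unitmx ->
  invmx X *m Y - 1%:M = invmx X *m (Y - X).
Proof. by move=> uX; rewrite mulmxBr mulVmx. Qed.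

(** [Y - X] and [X^-1 Y - 1] differ by multiplication by a fixed matrix, which is bounded in both
    directions. *)
Lemma closure_pointsP (X : 'M[Qp]_d) (S : set 'M[Qp]_d) : S `<=` points G Qp ->
  closure_in_points G S X <->
  points G Qp X /\ forall n, exists2 Y, S Y & Kn n (invmx X *m Y).
Proof.
move=> SG; have gG := points_group G Qp; have [_ _ GM GV] := gG.
split=> [[GX /closure_mxP clX]|[GX h]]; split=> //.
  move=> n; have [e [he _]] := mulmx_bounded d (invmx X).
  have [Y SY cY] := clX (n + e)%N; exists Y => //; split.
    by apply: GM; [exact: GV|exact: SG].
  by rewrite invmx_close ?(mx_group_unit gG) //; exact: he.
apply/closure_mxP => n; have [e [he _]] := mulmx_bounded d X.
have [Y SY [_ cY]] := h (n + e)%N; exists Y => //.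
have uX := mx_group_unit gG GX.
by rewrite -[Y - X](mulKVmx uX) -invmx_close //; exact: he.
Qed.

(** The group [G(Z[1/p])]. *)
Definition inv_p_points : set 'M[rat]_d :=
  [set M | points G rat M /\ inv_p_mx (intr : int -> rat) p M].

Let ratchar0 : [pchar rat] =i pred0 := pchar_num rat.

Lemma strong_approximation (X : 'M[Qp]_d) n : points G Qp X ->
  exists2 M, inv_p_points M & Kn n (invmx X *m map_mx phi M).
Proof.
move=> GX; have gG := points_group G Qp; have [_ _ GM GV] := gG.
have uX := mx_group_unit gG GX.
(* The extra precision absorbs the multiplication by [X^-1]. *)
suff [M LM cM] : exists2 M, inv_p_points M &
    pmul_mx iota p (n + sval (cid (mulmx_bounded d (invmx X)))) (map_mx phi M - X).
  exists M => //; split; first by apply: GM; [exact: GV|apply: points_map; case: LM].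
  by rewrite invmx_close //; case: cid cM => e /= [he _]; exact: he.
set n' := addn _ _; have [L LL XL] := points_log (pchar_padic p_pr) GX.
have [B [lieB spanB]] := lie_span G; have [y yE] := spanB _ phi _ LL.
have [b bE] := mx_continuous_expm L n'.
pose D : nat := (\prod_ij `|denq (B ij.1 ij.2)|)%N.
have Dgt0 : (0 < D)%N by apply: prodn_gt0 => ij; rewrite absz_gt0 denq_neq0.
have DB i j : exists a : int, D%:R * B i j = a%:~R.
  have /dvdnP[c cE] : (`|denq (B i j)| %| D)%N.
    by rewrite /D (bigD1 (i, j)) //= dvdn_mulr.
  exists (c%:Z * numq (B i j)); rewrite cE natrM -mulrA intrM; congr (_ * _).
  by rewrite numqE mulrC natr_absz gtr0_norm ?denq_gt0.
(* [D] clears the denominators of [B]; the factor [d!], carried by [L'], will compensate the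
   divisions by [k!] in the exponential. *)
pose c : nat := (D * d`!)%N.
have c0 (F : fieldType) : [pchar F] =i pred0 -> c%:R != 0 :> F.
  by move/pcharf0P => ->; rewrite -lt0n muln_gt0 Dgt0 fact_gt0.
have /choice[y' y'E] : forall i, exists r : rat, inv_p (intr : int -> rat) p r /\
    pmul iota p b (phi r - y 0 i / c%:R).
  by move=> i; have [r ? ?] := inv_p_dense (y 0 i / c%:R) b; exists r.
pose z : 'rV[rat]_(d * d) := \row_i y' i.
pose T : 'M[rat]_d := vec_mx (z *m (D%:R *: B)).
have Tinv : inv_p_mx (intr : int -> rat) p T.
  move=> i j; rewrite mxE mxE; apply: inv_p_sum => l _.
  apply: inv_p_M; first by rewrite mxE; case: (y'E l).
  rewrite mxE; have [a ->] := DB l (mxvec_index i j).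
  by apply: inv_p_pmul0; exact: pmul0_f.
(* The first form controls denominators, the second puts [L'] in the Lie algebra. *)
have [L' L'T L'E] : exists2 L' : 'M[rat]_d, L' = d`!%:R *: T &
    L' = vec_mx ((c%:R *: z) *m B).
  exists (d`!%:R *: T) => //.
  by rewrite /T -scalemxAr -scalemxAl -linearZ /= scalerA -natrM mulnC.
exists (expm L').
  split; first by apply: (expm_points ratchar0); rewrite L'E; exact: lieB.
  move=> i j; rewrite summxE; apply: inv_p_sum => k _.
  have -> : k`!%:R^-1 *: L' ^+ k = (d`! ^ k %/ k`!)%:R *: T ^+ k.
    have -> : L' ^+ k = d`!%:R ^+ k *: T ^+ k.
      elim: (nat_of_ord k) => [|m IHm]; first by rewrite !expr0 scale1r.
      by rewrite !exprS IHm L'T -!mulmxE -scalemxAl -scalemxAr scalerA.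
    (* [k!] divides [d!] since [k < d]; for [k = 0] the power is 1 and the case is apart. *)
    have kd : (k`! %| d`! ^ k)%N.
      case: (posnP k) => [->|k0]; first by rewrite fact0.
      apply: (@dvdn_trans d`!); last by rewrite -{1}[d`!]expn1 dvdn_exp2l.
      by rewrite -(bin_fact (ltnW (ltn_ord k))) mulnCA dvdn_mulr.
    by rewrite scalerA natf_div // natrX mulrC.
  rewrite mxE; apply: inv_p_M; first by apply: inv_p_pmul0; exact: pmul0_nat.
  elim: (nat_of_ord k) i j => [|m IHm] i j.
    by rewrite expr0 mxE; apply: inv_p_pmul0; exact: pmul0_nat.
  by rewrite exprS; apply: inv_p_mxM.
have -> : map_mx phi (expm L') = expm (map_mx phi L').
  rewrite raddf_sum; apply: eq_bigr => k _ /=; rewrite map_mxZ fmorphV rmorph_nat.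
  congr (_ *: _); exact: rmorphXn.
rewrite XL; apply: bE.
(* The error in the coordinates is multiplied by the integral matrix [D B] and by [d!], so no
   precision is lost. *)
have -> : map_mx phi L' - L =
    d`!%:R *: vec_mx ((map_mx phi z - c%:R^-1 *: y) *m map_mx phi (D%:R *: B)).
  rewrite map_mxZ rmorph_nat -scalemxAr -[RHS]linearZ /= scalerA -natrM mulnC -/c.
  rewrite mulmxBl scalerBr -!scalemxAl scalerA divff ?(c0 _ (pchar_padic p_pr)) //.
  rewrite scale1r linearB /= -yE mxvecK; congr (_ - _).
  by rewrite L'E map_vec_mx map_mxM map_mxZ rmorph_nat -scalemxAl.
move=> i j; rewrite mxE -[b]add0n; apply: pmul_M; first exact: pmul0_nat.
rewrite mxE mxE; apply: pmul_sum => l _; rewrite -[b]addn0; apply: pmul_M.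
  by rewrite !mxE mulrC; case: (y'E l).
rewrite !mxE; have [a ->] := DB l (mxvec_index i j).
by rewrite rmorph_int -(rmorph_int iota); exact: pmul0_f.
Qed.

End Group.
End PadicApproximation.

(** * The correspondence *)

(** In [D] as in [E], the common part is the preimage of that of [D'] and [E'], so both indices
    transfer. *)
Lemma comm_index_transfer (K L : fieldType) d (f : {rmorphism K -> L})
    (D E : set 'M[K]_d) (D' E' : set 'M[L]_d) n :
  mx_group D -> mx_group E -> mx_group D' -> mx_group E' ->
  (forall M, D M -> D' (map_mx f M)) -> (forall M, E M -> E' (map_mx f M)) ->
  (forall M, D M -> E' (map_mx f M) -> E M) ->
  (forall M, E M -> D' (map_mx f M) -> D M) ->
  (forall M', D' M' -> exists2 M, D M & (D' `&` E') (invmx (map_mx f M) *m M')) ->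
  (forall M', E' M' -> exists2 M, E M & (D' `&` E') (invmx (map_mx f M) *m M')) ->
  comm_index_eq D E n <-> comm_index_eq D' E' n.
Proof.
move=> gD gE gD' gE' DD EE DE ED denseD denseE.
have gI := mx_groupI gD gE; have gI' := mx_groupI gD' gE'.
have tD i : index_eq D (D `&` E) i <-> index_eq D' (D' `&` E') i.
  apply: (index_transfer (f := f)) => //; try exact: subIsetl.
  move=> M hM; split=> [[_ /EE ?]|[_ /(DE _ hM)]] //; split=> //; exact: DD.
have tE i : index_eq E (D `&` E) i <-> index_eq E' (D' `&` E') i.
  apply: (index_transfer (f := f)) => //; try exact: subIsetr.
  move=> M hM; split=> [[/DD ? _]|[/(ED _ hM) ? _]] //; split=> //; exact: EE.
by split=> -[i [j [hi hj ->]]]; exists i, j; split=> //;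
  [rewrite -tD|rewrite -tE|rewrite tD|rewrite tE].
Qed.

Lemma comm_index_ppower (A : comUnitRingType) d (D E : set 'M[A]_d) p k :
  prime p -> comm_index_eq D E (p ^ k) ->
  exists a b, index_eq D (D `&` E) (p ^ a) /\ index_eq E (D `&` E) (p ^ b).
Proof.
move=> p_pr [i [j [hi hj e]]].
have /(dvdn_pfactor _ _ p_pr)[a _ ia] : (i %| p ^ k)%N by rewrite e dvdn_mulr.
have /(dvdn_pfactor _ _ p_pr)[b _ jb] : (j %| p ^ k)%N by rewrite e dvdn_mull.
by exists a, b; rewrite -ia -jb.
Qed.

Section Correspondence.
Variables (R : realType) (d : nat) (G : unipotent_Zgroup d).
Variables (p : nat) (p_pr : prime p).
Local Notation Qp := (padic p_pr).
Local Notation iota := (@padic_of_int p p_pr).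
Local Notation phi := (@padic_of_rat p p_pr).
Local Notation Gamma := (integral_points G (intr : int -> rat)).
Local Notation Lambda := (inv_p_points p G).
Local Notation Kn := (congruence_points G iota p).

Let intr_injQ : injective (intr : int -> rat) := intr_inj.
Let intr_injR : injective (intr : int -> R) := intr_inj.
Let ratr_injR : injective (ratr : rat -> R) := fmorph_inj _.
Let iota_inj := @padic_of_int_inj p p_pr.
Let rat0 : [pchar rat] =i pred0 := pchar_num rat.
Let R0 : [pchar R] =i pred0 := pchar_num R.
Let Qp0 := pchar_padic p_pr.

Let gGamma : mx_group Gamma := integral_points_group G p intr_injQ.
Let gK : mx_group (padic_int_points G p_pr) := integral_points_group G p iota_inj.
Let gZ : mx_group (int_points G R) := integral_points_group G p intr_injR.

Definition rational_lattices n : set (set 'M[rat]_d) :=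
  [set E | [/\ mx_group E, E `<=` Lambda & comm_index_eq E Gamma n]].

Definition rational_part (Delta : set 'M[R]_d) : set 'M[rat]_d :=
  [set M | Delta (map_mx ratr M)].

Lemma map_ratr_inj : injective (map_mx (ratr : rat -> R) : 'M_d -> 'M_d).
Proof. exact: map_mx_inj. Qed.

Lemma map_ratr_intr (N : 'M[int]_d) : map_mx (ratr : rat -> R) (map_mx intr N) = map_mx intr N.
Proof. by apply/matrixP => i j; rewrite !mxE ratr_int. Qed.

Lemma integral_points_inv_p : Gamma `<=` Lambda.
Proof.
move=> M /(integral_pointsE G p intr_injQ)[GM hM]; split=> // i j.
exact: inv_p_pmul0.
Qed.

(** For a fixed [m], all [p ^ m]-th powers in the lattice are integral, and [root_inv_p] controls
    the denominators of their roots. *)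
Lemma lattice_ratr (Delta : set 'M[R]_d) k : lattices G R (p ^ k) Delta ->
  Delta `<=` map_mx ratr @` Lambda.
Proof.
move=> [[/subgroup_mx_group[DG gD] _] cD].
have [a [_ [hD _]]] := comm_index_ppower p_pr cD.
have [m mP] := index_ppower p_pr gD (mx_groupI gD gZ) (@subIsetl _ _ _) hD.
move=> M DM; have [_ ZM] := mP _ DM.
have p0R : p%:R != 0 :> R by rewrite pnatr_eq0 -lt0n prime_gt0.
have p0Q : p%:R != 0 :> rat by rewrite pnatr_eq0 -lt0n prime_gt0.
have hM : inv_p_mx (intr : int -> R) p M.
  apply: (root_inv_p p0R (m := m)); first exact: points_strictly_lower (DG _ DM).
  move/(integral_pointsE G p intr_injR): ZM => [_ hMm] i j.
  exact: inv_p_pmul0.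
have /choice[N NE] : forall ij : 'I_d * 'I_d, exists r : rat,
    inv_p (intr : int -> rat) p r /\ ratr r = M ij.1 ij.2.
  move=> [i j] /=; have [n [z]] := hM i j; rewrite mul1r => e.
  exists (z%:~R / p%:R ^+ n); split.
    by exists n, z; rewrite mul1r mulrCA divff ?mulr1 ?expf_neq0.
  by rewrite fmorph_div rmorphXn /= ratr_int ratr_nat -e mulrAC divff ?mul1r ?expf_neq0.
have e : map_mx ratr (\matrix_(i, j) N (i, j)) = M.
  by apply/matrixP => i j; rewrite !mxE; have [_ ->] := NE (i, j).
exists (\matrix_(i, j) N (i, j)) => //; split.
  by apply: (points_map_inj ratr_injR); rewrite e; exact: DG.
by move=> i j; rewrite mxE; have [] := NE (i, j).
Qed.

Lemma rational_part_lattice (Delta : set 'M[R]_d) k : lattices G R (p ^ k) Delta ->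
  rational_lattices (p ^ k) (rational_part Delta) /\
  Delta = map_mx ratr @` rational_part Delta.
Proof.
move=> LD; have sub := lattice_ratr LD.
have [[/subgroup_mx_group[DG gD] _] cD] := LD.
have [_ D1 DM DV] := gD.
have eD : Delta = map_mx ratr @` rational_part Delta.
  rewrite predeqE => M; split=> [hM|[N hN <-]] //.
  by have [N _ e] := sub _ hM; exists N => //; rewrite /rational_part /= e.
have EL : rational_part Delta `<=` Lambda.
  by move=> M /sub[N LN /map_ratr_inj <-].
have gE : mx_group (rational_part Delta).
  split.
  - by move=> M /EL[[]].
  - by rewrite /rational_part /= map_mx1.
  - by move=> M N hM hN; rewrite /rational_part /= map_mxM; exact: DM.
  - by move=> M hM; rewrite /rational_part /= map_invmx; exact: DV.
split=> //; split=> //.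
apply/(comm_index_transfer (f := ratr : {rmorphism rat -> R}) (D' := Delta)
  (E' := int_points G R)) => //.
- move=> _ [N GN <-]; exists N => //.
  by rewrite /= map_ratr_intr.
- move=> M hM [N GN e]; exists N => //; apply: map_ratr_inj; rewrite -e.
  exact: map_ratr_intr.
(* Every element of [Delta] comes from a rational one, so the approximation is exact. *)
- move=> M' hM'; have := hM'; rewrite {1}eD => -[M hM e]; exists M => //.
  rewrite e mulVmx ?(mx_group_unit gD) //.
  by have [] := mx_groupI gD gZ.
- move=> M' hM'; have [N GN e] := hM'.
  exists (map_mx intr N); first by exists N.
  have -> : map_mx ratr (map_mx intr N) = M'.
    by rewrite -e; exact: map_ratr_intr.
  rewrite mulVmx ?(mx_group_unit gZ) //.
  by have [] := mx_groupI gD gZ.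
Qed.

Lemma rational_lattice_real n E : rational_lattices n E ->
  lattices G R n (map_mx ratr @` E) /\ rational_part (map_mx ratr @` E) = E.
Proof.
move=> [gE EL cE]; have [_ E1 EM EV] := gE.
set Delta := map_mx ratr @` E.
have DG : Delta `<=` points G R by move=> _ [M /EL[GM _] <-]; exact: points_map.
have gD : mx_group Delta.
  split.
  - by move=> M /DG[].
  - by exists 1%:M; rewrite ?map_mx1.
  - move=> _ _ [M hM <-] [N hN <-]; exists (M *m N); first exact: EM.
    exact: map_mxM.
  - by move=> _ [M hM <-]; exists (invmx M); [exact: EV|exact: map_invmx].
have cD : comm_index_eq Delta (int_points G R) n.
  apply/(comm_index_transfer (f := ratr : {rmorphism rat -> R}) (D := E)
    (E := Gamma)) => //.
  - by move=> M hM; exists M.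
  - move=> _ [N GN <-]; exists N => //.
    by rewrite /= map_ratr_intr.
  - move=> M hM [N GN e]; exists N => //; apply: map_ratr_inj; rewrite -e.
    exact: map_ratr_intr.
  - by move=> M _ [N hN /map_ratr_inj <-].
  - move=> _ [M hM <-]; exists M => //.
    rewrite mulVmx; last by apply: (mx_group_unit gD); exists M.
    by have [] := mx_groupI gD gZ.
  - move=> M' hM'; have [N GN e] := hM'.
    exists (map_mx intr N); first by exists N.
    have -> : map_mx ratr (map_mx intr N) = M'.
      by rewrite -e; exact: map_ratr_intr.
    rewrite mulVmx ?(mx_group_unit gZ) //.
    by have [] := mx_groupI gD gZ.
split; last first.
  rewrite predeqE => M; split=> [[N hN /map_ratr_inj <-]//|hM]; by exists M.
split=> //; split; last by exists n.
by apply/subgroup_mx_group.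
Qed.

Definition padic_trace (H : set 'M[Qp]_d) : set 'M[rat]_d :=
  [set M | Lambda M /\ H (map_mx phi M)].

Lemma inv_p_points_congruence n M : Lambda M -> Kn n (map_mx phi M) ->
  congruence_points G (intr : int -> rat) p n M.
Proof.
move=> [GM hM] [_ hK]; split=> // i j.
apply: (@inv_p_ratr_pmul p p_pr); last first.
  by have := hK i j; rewrite -(map_mx1 phi) -map_mxB mxE.
rewrite !mxE; apply: inv_p_D; first exact: hM.
by apply: inv_p_N; apply: inv_p_pmul0; exact: pmul0_nat.
Qed.

Lemma padic_trace_group H : H `<=` points G Qp -> mx_group H ->
  mx_group (padic_trace H).
Proof.
move=> HG [uH H1 HM HV]; have [_ G1 GM GV] := points_group G rat.
have inv_p1 : inv_p_mx (intr : int -> rat) p (1%:M : 'M_d).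
  by move=> i j; apply: inv_p_pmul0; exact: pmul_mx1.
split.
- by move=> M [[[]]].
- by split; rewrite ?map_mx1.
- move=> M N [[gM iM] hM] [[gN iN] hN]; rewrite /padic_trace /= map_mxM.
  by split; [split; [exact: GM|exact: inv_p_mxM]|exact: HM].
- move=> M [[gM iM] hM]; rewrite /padic_trace /= map_invmx.
  split; last exact: HV.
  split; first exact: GV.
  rewrite invmx_unitriangular; last by case: gM.
  move=> i j; rewrite summxE; apply: inv_p_sum => l _.
  have iN : inv_p_mx (intr : int -> rat) p (1%:M - M).
    move=> a b; rewrite !mxE; apply: inv_p_D; last by apply: inv_p_N; exact: iM.
    by apply: inv_p_pmul0; exact: pmul0_nat.
  elim: (nat_of_ord l) i j => [|m IHm] i j; first by rewrite expr0; exact: inv_p1.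
  by rewrite exprS; apply: inv_p_mxM.
Qed.

(** [H] and [G(Z_p)] contain [Kn m], so the density of [G(Z[1/p])] provides representatives of all
    their cosets. *)
Lemma comm_index_trace H m n : H `<=` points G Qp -> mx_group H -> Kn m `<=` H ->
  comm_index_eq (padic_trace H) Gamma n <->
  comm_index_eq H (padic_int_points G p_pr) n.
Proof.
move=> HG gH KH.
have gKm := congruence_points_group G p iota_inj m.
have KmK : Kn m `<=` padic_int_points G p_pr.
  by move=> X /(congruence_points_le (leq0n m)); rewrite congruence_points0.
have KmI : Kn m `<=` H `&` padic_int_points G p_pr by move=> X hX; split; [exact: KH|exact: KmK].
have [_ _ _ KV] := gKm.
(* An approximation modulo [Kn m] of an element of [S] stays in [S], because [S] contains [Kn m]. *)
have approx (S : set 'M[Qp]_d) X : S `<=` points G Qp -> mx_group S -> Kn m `<=` S ->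
    S X -> exists M, [/\ Lambda M, S (map_mx phi M) & Kn m (invmx (map_mx phi M) *m X)].
  move=> SG gS KS SX; have [M LM hM] := strong_approximation m (SG _ SX).
  have [_ _ SM SV] := gS; have uX := mx_group_unit gS SX.
  have e : map_mx phi M = X *m (invmx X *m map_mx phi M) by rewrite mulKVmx.
  have SphiM : S (map_mx phi M) by rewrite e; apply: SM => //; exact: KS.
  exists M; split=> //.
  by rewrite -invmx_mulV ?(mx_group_unit gS SphiM) //; exact: KV.
have KG : padic_int_points G p_pr `<=` points G Qp.
  by move=> X /(integral_pointsE G p iota_inj)[].
have GammaK M : Lambda M -> padic_int_points G p_pr (map_mx phi M) -> Gamma M.
  move=> LM hM; rewrite -(congruence_points0 G p intr_injQ).
  by apply: inv_p_points_congruence => //; rewrite congruence_points0.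
refine (comm_index_transfer (f := phi) _ (padic_trace_group HG gH) gGamma gH gK
  _ _ _ _ _ _).
- by move=> M [_ hM].
- move=> _ [N GN <-]; exists (map_mx intr N); first exact: points_map.
  by apply/matrixP => i j; rewrite !mxE !rmorph_int.
- by move=> M [LM _]; exact: GammaK.
- by move=> M /integral_points_inv_p LM hM; split.
- move=> X HX; have [M [LM HM KM]] := approx H X HG gH KH HX.
  by exists M => //; exact: KmI.
- move=> X HX; have [M [LM HM KM]] := approx _ X KG gK KmK HX.
  by exists M; [exact: GammaK|exact: KmI].
Qed.

(** [E] contains a congruence subgroup of [G(Z)], hence all points of [G(Z[1/p])] in [Kn m]. With
    density this makes the closure open, and the closure gains no new point of [G(Z[1/p])]. *)
Lemma rational_lattice_closure E k : rational_lattices (p ^ k) E ->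
  let H := closure_in_points G (map_mx phi @` E) in
  [/\ mx_group H, closure_in_points G H = H, exists m, Kn m `<=` H & padic_trace H = E].
Proof.
move=> [gE EL cE] H; have [_ E1 EM EV] := gE.
have gG := points_group G Qp; have [_ G1 GM GV] := gG.
have unG X : points G Qp X -> X \in unitmx by exact: mx_group_unit.
have phiG M : E M -> points G Qp (map_mx phi M) by move=> /EL[GM' _]; exact: points_map.
have EG : map_mx phi @` E `<=` points G Qp by move=> _ [M hM <-]; exact: phiG.
have gKn n := congruence_points_group G p iota_inj n.
have [_ [b [_ cb]]] := comm_index_ppower p_pr cE.
have [m mE] : exists m, congruence_points G (intr : int -> rat) p m `<=` E.
  have [m mE] := index_ppower_open intr_injQ rat0 p_pr (mx_groupI gE gGamma)
    (@subIsetr _ _ _) cb.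
  by exists m => M /mE[].
have traceE M : Lambda M -> Kn m (map_mx phi M) -> E M.
  by move=> LM /(inv_p_points_congruence LM)/mE.
have HP X : H X <-> points G Qp X /\
    forall n, exists2 M, E M & Kn n (invmx X *m map_mx phi M).
  rewrite /H (closure_pointsP _ EG); split=> -[GX h]; (split; first exact: GX) => n.
    by have [_ [M hM <-] hK] := h n; exists M; [exact: hM|exact: hK].
  by have [M hM hK] := h n; exists (map_mx phi M); [exists M|exact: hK].
(* [Kn n] need not be normal in [G(Q_p)], but conjugation by a fixed matrix is continuous at 1. *)
have conj X n : points G Qp X ->
    exists n', forall Y, Kn n' Y -> Kn n (X *m Y *m invmx X).
  move=> GX; have [e [he _]] := mulmx_bounded d X.
  have [e' [_ he']] := mulmx_bounded d (invmx X).
  exists (n + e' + e)%N => Y [GY hY]; split; first exact: (GM _ _ (GM _ _ GX GY) (GV _ GX)).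
  rewrite (conjmx_sub1 _ (unG _ GX)).
  by apply: he'; exact: he.
have gH : mx_group H.
  split.
  - by move=> X /HP[[]].
  - apply/HP; split=> [|n]; first exact: G1.
    have [_ K1 _ _] := gKn n; exists 1%:M; first exact: E1.
    by rewrite map_mx1 mulmx1 invmx1; exact: K1.
  - move=> X Y /HP[GX hX] /HP[GY hY]; apply/HP; split=> [|n]; first exact: GM.
    have [N hN NY] := hY n; have [n' n'P] := conj _ n (GV _ (phiG _ hN)).
    have [M hM MX] := hX n'; exists (M *m N); first exact: EM.
    rewrite map_mxM (invmxM_conj _ (unG _ GX) (unG _ GY) (unG _ (phiG _ hN))).
    by have [_ _ KM _] := gKn n; exact: (KM _ _ NY (n'P _ MX)).
  - move=> X /HP[GX hX]; apply/HP; split=> [|n]; first exact: GV.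
    have [n' n'P] := conj _ n GX; have [M hM MX] := hX n'.
    exists (invmx M); first exact: EV.
    rewrite invmxK map_invmx.
    rewrite (invmx_conj (unG _ GX) (unG _ (phiG _ hM))).
    by have [_ _ _ KV] := gKn n'; exact: (n'P _ (KV _ MX)).
(* An approximation of an element of [Kn m] to precision at least [m] is itself in [Kn m], hence
   comes from [E]. *)
have KmH : Kn m `<=` H.
  move=> X hX; apply/HP; split=> [|n]; first by case: hX.
  have [M LM hM] := strong_approximation (maxn m n) (hX.1).
  exists M; last exact: congruence_points_le (leq_maxr _ _) _ hM.
  apply: (traceE _ LM); rewrite -[map_mx _ _](mulKVmx (unG _ hX.1)).
  have [_ _ KM _] := gKn m; apply: (KM _ _ hX).
  exact: congruence_points_le (leq_maxl _ _) _ hM.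
split=> //; last first.
- rewrite predeqE => M; split=> [[LM /HP[_ /(_ m)[N hN hK]]]|hM].
    have LN := EL _ hN.
    have gL : mx_group (padic_trace (points G Qp)) by exact: padic_trace_group.
    have LE X : padic_trace (points G Qp) X <-> Lambda X.
      split=> [[LX _]|LX]; first exact: LX.
      by split; [exact: LX|have [GX _] := LX; exact: points_map].
    have uM := mx_group_unit gL ((LE _).2 LM).
    (* [M] differs from the nearby element [N] of [E] by an element of [Kn m] over [Z[1/p]], which
       is in [E]. *)
    have /EV : E (invmx M *m N).
      apply: traceE; last by rewrite map_mxM map_invmx.
      apply/LE; have [_ _ LM' LV] := gL; apply: LM'; last exact/LE.
      by apply: LV; exact/LE.
    rewrite invmx_mulV ?(mx_group_unit gE hN) // => /(EM _ _ hN).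
    by rewrite mulKVmx ?(mx_group_unit gE hN).
  split; first exact: EL.
  apply/HP; split=> [|n]; first exact: phiG.
  have [_ K1 _ _] := gKn n; exists M; first exact: hM.
  by rewrite (mulVmx (unG _ (phiG _ hM))); exact: K1.
- by exists m.
rewrite predeqE => X; split=> [[GX clX]|[GX clX]]; split=> //.
  by apply: closed_closure; apply: closureS clX => Y [].
by apply: subset_closure.
Qed.

(** [H] contains some [Kn m]. A limit of points of [H] agrees with one of them modulo [Kn m], so it
    is in [H]; conversely, points of [G(Z[1/p])] close enough to an element of [H] lie in [H]. *)
Lemma closed_subgroup_trace H k : closed_subgroups G p_pr (p ^ k) H ->
  rational_lattices (p ^ k) (padic_trace H) /\
  closure_in_points G (map_mx phi @` padic_trace H) = H.
Proof.
move=> [/subgroup_mx_group[HG gH] _ cH].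
have [_ [b [_ cb]]] := comm_index_ppower p_pr cH.
have [m mH] : exists m, Kn m `<=` H.
  have [m mH] := index_ppower_open iota_inj Qp0 p_pr (mx_groupI gH gK)
    (@subIsetr _ _ _) cb.
  by exists m => X /mH[].
have [_ H1 HM HV] := gH.
split; first split.
- exact: padic_trace_group.
- by move=> M [].
- exact/(comm_index_trace _ HG gH mH).
have unH X : points G Qp X -> X \in unitmx by exact/mx_group_unit/points_group.
rewrite predeqE => X; rewrite closure_pointsP; last by move=> _ [M [_ hM] <-]; exact: HG.
split=> [[GX /(_ m)[_ [M [_ hM] <-] /mH hX]]|HX].
  have uM := unH _ (HG _ hM); have := HM _ _ hM (HV _ hX).
  by rewrite (invmx_mulV (unH _ GX) uM) (mulKVmx uM).
split=> [|n]; first exact: HG.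
have [M LM hM] := strong_approximation (maxn m n) (HG _ HX).
exists (map_mx phi M); last exact: congruence_points_le (leq_maxr _ _) _ hM.
exists M => //; split=> //.
rewrite -[map_mx _ _](mulKVmx (unH _ (HG _ HX))); apply: (HM _ _ HX).
by apply: mH; exact: congruence_points_le (leq_maxl _ _) _ hM.
Qed.

End Correspondence.

Theorem lemma3p5 (R : realType) (d : nat) (G : unipotent_Zgroup d)
    (p : nat) (p_pr : prime p) (k : nat) :
  set_bij (lattices G R (p ^ k)) (closed_subgroups G p_pr (p ^ k))
    (lattice_closure G p_pr R).
Proof.
have closE Delta : lattice_closure G p_pr R Delta =
    closure_in_points G (map_mx (@padic_of_rat p p_pr) @` rational_part Delta) by [].
split.
- move=> Delta LD; have [rD _] := rational_part_lattice p_pr LD; rewrite /= closE.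
  have [gH clH [m mH] trH] := rational_lattice_closure p_pr rD.
  set H := closure_in_points _ _ in gH clH mH trH *.
  have HG : H `<=` points G (padic p_pr) by move=> X [].
  split=> //; first exact/subgroup_mx_group.
  by apply/(comm_index_trace _ HG gH mH); rewrite trH; case: rD.
(* A lattice is the image of its rational part, and the rational part is the trace of the closure;
   so the closure determines the lattice. *)
- move=> D D'; rewrite !inE => LD LD'; rewrite !closE => e.
  have [rD ->] := rational_part_lattice p_pr LD; have [rD' ->] := rational_part_lattice p_pr LD'.
  have [_ _ _ <-] := rational_lattice_closure p_pr rD.
  by have [_ _ _ <-] := rational_lattice_closure p_pr rD'; rewrite e.
(* The preimage of [H] is the real image of its trace. *)
- move=> H cH; have [rH clH] := closed_subgroup_trace cH.
  have [LD part] := rational_lattice_real R rH.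
  by exists (map_mx ratr @` padic_trace G H) => //; rewrite closE part.
Qed.
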